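(* The satisfiability problem for the propositional separation logic $\mathrm{SL}( *,-\!*,\mathrm{ls})$ is undecidable.
   Context: Fix a countably infinite set $\mathrm{PVAR}$ of program variables and a countably infinite set $\mathrm{LOC}$ of locations (e.g. $\mathbb{N}$). A memory state is a pair $(s,h)$ where $s:\mathrm{PVAR}\to\mathrm{LOC}$ (the store) and $h$ is a partial function $\mathrm{LOC}\to\mathrm{LOC}$ with finite domain $\mathrm{dom}(h)$ (the heap). Heaps $h_1,h_2$ are disjoint if $\mathrm{dom}(h_1)\cap\mathrm{dom}(h_2)=\emptyset$; then $h_1+h_2$ denotes their union. Formulas of $\mathrm{SL}( *,-\!*,\mathrm{ls})$ are built from atomic formulas $x=y$, $x\hookrightarrow y$, $\mathrm{ls}(x,y)$, $\mathrm{emp}$ (with $x,y\in\mathrm{PVAR}$) using $\neg$, $\wedge$, $*$ (separating conjunction) and $-\!*$ (separating implication). Semantics: $(s,h)\models x=y$ iff $s(x)=s(y)$; $(s,h)\models\mathrm{emp}$ iff $\mathrm{dom}(h)=\emptyset$; $(s,h)\models x\hookrightarrow y$ iff $s(x)\in\mathrm{dom}(h)$ and $h(s(x))=s(y)$; $(s,h)\models\mathrm{ls}(x,y)$ iff either ($\mathrm{dom}(h)=\emptyset$ and $s(x)=s(y)$) or $h=\{l_0\mapsto l_1,\dots,l_{n-1}\mapsto l_n\}$ with $n\ge 1$, $l_0=s(x)$, $l_n=s(y)$ and $l_0,\dots,l_n$ pairwise distinct; Boolean connectives as usual; $(s,h)\models\varphi_1*\varphi_2$ iff there are disjoint $h_1,h_2$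 with $h=h_1+h_2$, $(s,h_1)\models\varphi_1$ and $(s,h_2)\models\varphi_2$; $(s,h)\models\varphi_1-\!*\varphi_2$ iff for every heap $h_1$ disjoint from $h$ with $(s,h_1)\models\varphi_1$ we have $(s,h+h_1)\models\varphi_2$. The satisfiability problem asks, given a formula, whether some memory state satisfies it. *)

(* Defs.v *)
From mathcomp Require Import all_boot finmap.

Set Implicit Arguments.
Unset Strict Implicit.
Unset Printing Implicit Defensive.

Local Open Scope fset_scope.
Local Open Scope fmap_scope.

Definition PVAR := nat.
Definition LOC := nat.

Definition store := PVAR -> LOC.
Definition heap := {fmap LOC -> LOC}.

Inductive form : Type :=
| Eq of PVAR & PVAR
| PointsTo of PVAR & PVAR
| Ls of PVAR & PVAR
| Emp
| Neg of form
| And of form & form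
| Star of form & form
| Wand of form & form.

(* [is_path h n l] : h is the graph {l 0 |-> l 1, ..., l (n-1) |-> l n} *)
Definition is_path (h : heap) (n : nat) (l : nat -> LOC) : Prop :=
  forall a b : LOC,
    h.[? a] = Some b <-> exists i, [/\ i < n, a = l i & b = l i.+1].

Definition ls_heap (h : heap) (a b : LOC) : Prop :=
  (domf h = fset0 /\ a = b) \/
  exists (n : nat) (l : nat -> LOC),
    [/\ 1 <= n, l 0 = a, l n = b,
        (forall i j, i <= n -> j <= n -> l i = l j -> i = j)
      & is_path h n l].

(* On heaps with disjoint domains, finmap's [h1 + h2] is the union h1 + h2. *)
Fixpoint sat (s : store) (h : heap) (phi : form) : Prop :=
  match phi with
  | Eq x y => s x = s y
  | PointsTo x y => h.[? s x] = Some (s y)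
  | Ls x y => ls_heap h (s x) (s y)
  | Emp => domf h = fset0
  | Neg p => ~ sat s h p
  | And p q => sat s h p /\ sat s h q
  | Star p q => exists h1 h2 : heap,
      [/\ [disjoint domf h1 & domf h2], h = h1 + h2, sat s h1 p & sat s h2 q]
  | Wand p q => forall h1 : heap,
      [disjoint domf h & domf h1] -> sat s h1 p -> sat s (h + h1) q
  end.

Definition satisfiable (phi : form) : Prop :=
  exists (s : store) (h : heap), sat s h phi.

(* Partial recursive functions of arity n, and their graphs.  The recursion   *)
(* argument of [rprec] and the search argument of [rmin] come first.          *)
Inductive recfun : nat -> Type :=
| rzero : recfun 0
| rsucc : recfun 1
| rproj n (i : 'I_n) : recfun n
| rcomp m n (f : recfun m) (g : 'I_m -> recfun n) : recfun n
| rprec n (f : recfun n) (g : recfun n.+2) : recfun n.+1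
| rmin n (f : recfun n.+1) : recfun n.

Fixpoint reval n (f : recfun n) : n.-tuple nat -> nat -> Prop :=
  match f in recfun n return n.-tuple nat -> nat -> Prop with
  | rzero => fun _ y => y = 0
  | rsucc => fun v y => y = (thead v).+1
  | rproj _ i => fun v y => y = tnth v i
  | rcomp m _ f g => fun v y =>
      exists2 w : m.-tuple nat, (forall i, reval (g i) v (tnth w i)) & reval f w y
  | rprec n f g => fun v y =>
      let u : n.-tuple nat := [tuple of behead v] in
      (fix rec (k y : nat) : Prop :=
         match k with
         | 0 => reval f u y
         | k'.+1 => exists2 z, rec k' z & reval g [tuple of k' :: z :: u] y
         end) (thead v) y
  | rmin _ f => fun v y =>
      reval f [tuple of y :: v] 0 /\
      forall k, k < y -> exists z, reval f [tuple of k :: v] z.+1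
  end.

Lemma reval_functional n (f : recfun n) (v : n.-tuple nat) (y1 y2 : nat) :
  reval f v y1 -> reval f v y2 -> y1 = y2.
Proof.
elim: f v y1 y2 => {n} /=.
- by move=> _ y1 y2 -> ->.
- by move=> v y1 y2 -> ->.
- by move=> n i v y1 y2 -> ->.
- move=> m n f IHf g IHg v y1 y2 [w1 g1 f1] [w2 g2 f2].
  have e : w1 = w2 by apply: eq_from_tnth => i; apply: IHg (g1 i) (g2 i).
  by subst w2; apply: IHf f1 f2.
- move=> n f IHf g IHg v; elim: (thead v) => [|k IHk] y1 y2; first exact: IHf.
  move=> [z1 r1 e1] [z2 r2 e2]; have e := IHk _ _ r1 r2.
  by subst z2; apply: IHg e1 e2.
- move=> n f IHf v y1 y2 [z1 m1] [z2 m2]; case: (ltngtP y1 y2) => // lt.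
  + by have [z /(IHf _ _ _ z1)] := m2 _ lt.
  + by have [z /(IHf _ _ _ z2)] := m1 _ lt.
Qed.

(* Decidability of a predicate on a type of codable objects: the              *)
(* characteristic function, read on codes, is partial recursive.              *)
Definition recursively_decidable (T : Type) (code : T -> nat) (P : T -> Prop) :
    Prop :=
  exists f : recfun 1, forall t : T,
    (P t -> reval f [tuple code t] 1) /\ (~ P t -> reval f [tuple code t] 0).

(* Goedel numbering; [CodeSeq.code] is an effective bijection seq nat -> nat. *)
Fixpoint form_code (phi : form) : nat :=
  CodeSeq.code
    match phi with
    | Eq x y => [:: 0; x; y]
    | PointsTo x y => [:: 1; x; y]
    | Ls x y => [:: 2; x; y]
    | Emp => [:: 3]
    | Neg p => [:: 4; form_code p]
    | And p q => [:: 5; form_code p; form_code q]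
    | Star p q => [:: 6; form_code p; form_code q]
    | Wand p q => [:: 7; form_code p; form_code q]
    end.

Lemma form_code_inj : injective form_code.
Proof.
elim=> [x y|x y|x y||p IHp|p IHp q IHq|p IHp q IHq|p IHp q IHq];
  case=> [x' y'|x' y'|x' y'||p'|p' q'|p' q'|p' q'];
  move=> /(can_inj CodeSeq.codeK) // [];
  by [move=> -> -> | move=> /IHp -> /IHq -> | move=> /IHp ->].
Qed.

(* Main.v *)
(* A natural number x_i is represented by the number of heap cells that
   point to the location of a program variable. Removing and adding such
   cells (separating conjunction and implication) quantifies over x_i, and
   pointers from auxiliary program variables simulate quantification over
   locations, ls being used to compare and follow them. The relation x_i *
   x_j <= x_k then becomes expressible by guessing a rewiring of the heap,
   so that, through Gödel's beta function, for every partial recursive f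
   there is a formula p such that the conjunction of p and of a formula
   saying that the heap has n cells is satisfiable iff f(n) = 0. If
   satisfiability were decided by a recursive function, taking for f its
   composition with the map sending the code n of p to the code of that
   conjunction would give a p for which, at n = code of p, the conjunction
   is satisfiable iff it is not. *)

(* The obstacle is that [PointsTo] sees only one step from a variable, and no formula can name a
   location. [ls] is used only on subheaps of exactly two or three cells: a location is stored as
   the target of a variable's cell, two steps read its color, and three steps compare the target of
   its cell with another stored location. The comparison relies on a marker to which no cell points,
   so that every path to the marker ends with a cell just added. A guessed rewiring certifies only
   an inequality: one fiber of at least [x_j] cells for each of [x_i] cells, all disjoint, fit among
   [x_k] cells. Order, successor and the exact product are then obtained by minimality, negation
   being available, and the sum by an identity of Julia Robinson. The diagonalization needs neither
   a universal machine nor the substitution of numerals inside [p]: the input is the number of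
   cells, and [szf n], conjoined from outside, has a code primitive recursive in [n]. *)
From Stdlib Require Import Classical.
From mathcomp Require Import all_boot finmap zify.
Require Import Defs.

Set Implicit Arguments.
Unset Strict Implicit.
Unset Printing Implicit Defensive.

Local Open Scope fset_scope.
Local Open Scope fmap_scope.
Local Open Scope nat_scope.

(** * Heaps *)

Lemma notin_domf (h : heap) a : a \notin domf h <-> h.[? a] = None.
Proof. by case: fndP => [k|k]; split=> //; rewrite k. Qed.

Lemma in_domf (h : heap) a : a \in domf h <-> exists b, h.[? a] = Some b.
Proof.
case: fndP => [k|/negP k]; split=> //; last by case.
by exists h.[k].
Qed.

Lemma domf_eq0 (h : heap) : domf h = fset0 -> h = [fmap].
Proof.
move=> e; apply/fmapP => a; rewrite fnd_fmap0; apply/notin_domf.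
by rewrite e inE.
Qed.

Definition dj (h1 h2 : heap) := forall a, h1.[? a] = None \/ h2.[? a] = None.

Lemma djP (h1 h2 : heap) : [disjoint domf h1 & domf h2]%fset <-> dj h1 h2.
Proof.
split=> [/fdisjointP d a|d].
- case: (boolP (a \in domf h1)) => [/d|] /notin_domf; [by right|by left].
- by apply/fdisjointP => a k; apply/notin_domf; case: (d a) => // /notin_domf; rewrite k.
Qed.

Lemma fnd_join (h1 h2 : heap) a :
  (h1 + h2)%fset.[? a] = if h2.[? a] is Some b then Some b else h1.[? a].
Proof.
rewrite fnd_cat; case: ifP => [/in_domf [b ->] //|/negbT k].
by have /notin_domf -> : a \notin domf h2.
Qed.

Lemma fnd_joinP (h1 h2 : heap) a b : dj h1 h2 ->
  (h1 + h2)%fset.[? a] = Some b <-> h1.[? a] = Some b \/ h2.[? a] = Some b.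
Proof.
move=> /(_ a) d; rewrite fnd_join.
by case: h2.[? a] d => [c|] [] // e; intuition congruence.
Qed.

Lemma dj_sym (h1 h2 : heap) : dj h1 h2 -> dj h2 h1.
Proof. by move=> d a; case: (d a); [right|left]. Qed.

Definition subh (h1 h2 : heap) :=
  forall a b, h1.[? a] = Some b -> h2.[? a] = Some b.

Lemma subh_split (h1 h : heap) : subh h1 h ->
  dj h1 h.[\ domf h1] /\ h = (h1 + h.[\ domf h1])%fset.
Proof.
move=> sb; split=> [a|].
- rewrite fnd_rem; case: ifP; [by right|move=> /negbT k; left; exact/notin_domf].
- apply/fmapP => a; rewrite fnd_join fnd_rem.
  case: ifP => [/in_domf [b e]|/negbT /notin_domf ->]; last by case: h.[? a].
  by rewrite e (sb _ _ e).
Qed.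

Definition single (a b : LOC) : heap := [fmap].[a <- b].

Lemma fnd_single a b x : (single a b).[? x] = if x == a then Some b else None.
Proof. by rewrite fnd_set fnd_fmap0. Qed.

Lemma dj_single (h : heap) a b : h.[? a] = None -> dj h (single a b).
Proof. by move=> e x; rewrite fnd_single; case: eqP => [->|]; [left|right]. Qed.

Definition mkheap (r : seq LOC) (f : LOC -> LOC) : heap :=
  foldr (fun a h => h.[a <- f a]) [fmap] r.

Lemma fnd_mkheap r f a : (mkheap r f).[? a] = if a \in r then Some (f a) else None.
Proof.
elim: r => [|x r IH]; first by rewrite fnd_fmap0.
by rewrite /= fnd_set inE; case: eqP => [->|].
Qed.

Lemma heap_bound (h : heap) : exists B, forall a, B <= a -> h.[? a] = None.
Proof.
exists (\max_(a <- domf h) a).+1 => a lt; apply/notin_domf/negP => k.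
by have := @leq_bigmax_seq _ (enum_fset (domf h)) xpredT id a k isT; rewrite leqNgt lt.
Qed.

(** * Derived formulas *)

Definition topf := Neg (And Emp (Neg Emp)).
Definition orf p q := Neg (And (Neg p) (Neg q)).
(** Septraction, the existential dual of the wand: it guesses cells to be added. *)
Definition septr p q := Neg (Wand p (Neg q)).
Definition subf p := Star p topf.
(** A cell from [x] to itself can be added exactly when [x] is not allocated; the wand to falsity
    excludes this. *)
Definition alloc x := Wand (PointsTo x x) (Neg topf).
Definition size1 := And (Neg Emp) (Neg (Star (Neg Emp) (Neg Emp))).
(** Conveys the input to the formula of [representation]; [rszf] follows this recursion on codes. In
    [pathf] it fixes the length of a path. *)
Fixpoint szf n := if n is m.+1 then Star size1 (szf m) else Emp.
(** [Ls] alone allows any length and constrains the whole heap; counting the cells of a subheap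
    yields paths of length exactly [n] in a larger heap. *)
Definition pathf n z x := subf (And (Ls z x) (szf n)).
Fixpoint conjf n (F : nat -> form) :=
  if n is m.+1 then And (F m) (conjf m F) else topf.

Section Sat.
Variable s : store.
Implicit Type h : heap.

Lemma sat_top h : sat s h topf.
Proof. by move=> []. Qed.

Lemma sat_and h p q : sat s h (And p q) <-> sat s h p /\ sat s h q.
Proof. by []. Qed.

Lemma sat_neg h p : sat s h (Neg p) <-> ~ sat s h p.
Proof. by []. Qed.

Lemma sat_eq h x y : sat s h (Eq x y) <-> s x = s y.
Proof. by []. Qed.

Lemma sat_points h x y : sat s h (PointsTo x y) <-> h.[? s x] = Some (s y).
Proof. by []. Qed.

Lemma sat_star h p q : sat s h (Star p q) <-> exists h1 h2,
  [/\ dj h1 h2, h = (h1 + h2)%fset, sat s h1 p & sat s h2 q].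
Proof. by split=> -[h1 [h2 [/djP d -> p1 p2]]]; exists h1, h2; split=> //; exact/djP. Qed.

Lemma sat_or h p q : sat s h (orf p q) <-> sat s h p \/ sat s h q.
Proof. by split=> /= [n|]; [apply: NNPP; tauto|tauto]. Qed.

Lemma sat_septr h p q : sat s h (septr p q) <->
  exists h', [/\ dj h h', sat s h' p & sat s (h + h')%fset q].
Proof.
split=> /= [n|[h' [/djP d p1 p2]]]; last by move=> /(_ h' d p1).
by apply: NNPP => N; apply: n => h' /djP d p1 p2; apply: N; exists h'.
Qed.

Lemma sat_sub h p : sat s h (subf p) <-> exists h', subh h' h /\ sat s h' p.
Proof.
split=> [[h1 [h2 [/djP d -> p1 _]]]|[h' [sb p1]]].
- by exists h1; split=> // a b e; apply/fnd_joinP; [|left].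
- have [d e] := subh_split sb.
  by exists h', h.[\ domf h']; split=> //; [exact/djP|exact: sat_top].
Qed.

Lemma sat_alloc h x : sat s h (alloc x) <-> h.[? s x] <> None.
Proof.
split=> [A N|N h1 /djP d /= e]; last by case: (d (s x)) => //; rewrite e.
apply: (A (single (s x) (s x))); last exact: sat_top.
- exact/djP/dj_single.
- by rewrite /= fnd_single eqxx.
Qed.

Lemma sat_conj h n F : sat s h (conjf n F) <-> forall i, i < n -> sat s h (F i).
Proof.
elim: n => [|n IH] /=; first by split=> // _; exact: sat_top.
split=> [[p /IH q] i|p].
- by rewrite ltnS leq_eqVlt => /orP [/eqP ->|/q].
- by split; [exact: p|apply/IH => i lt; apply: p; exact: ltnW].
Qed.

Lemma domf_neq0 h : domf h <> fset0 <-> exists a b, h.[? a] = Some b.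
Proof.
split=> [/eqP /fset0Pn [a /in_domf]|[a [b e]] z]; first by exists a.
have : a \in domf h by apply/in_domf; exists b.
by rewrite z inE.
Qed.

Lemma sat_size1 h : sat s h size1 <-> exists a b, h = single a b.
Proof.
split=> /= [[/domf_neq0 [a [b e]] n]|[a [b ->]]].
- exists a, b; apply: NNPP => N; apply: n.
  have sb : subh (single a b) h.
    by move=> x y; rewrite fnd_single; case: eqP => // -> [<-].
  have [d eh] := subh_split sb.
  exists (single a b), h.[\ domf (single a b)]; split=> //; first exact/djP.
  + by apply/domf_neq0; exists a, b; rewrite fnd_single eqxx.
  + by move=> /domf_eq0 z; apply: N; rewrite [LHS]eh z catf0.
- split; first by apply/domf_neq0; exists a, b; rewrite fnd_single eqxx.
  move=> [h1 [h2 [/djP d e /domf_neq0 [x [y ex]] /domf_neq0 [x' [y' ex']]]]].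
  have k : forall z w, h1.[? z] = Some w \/ h2.[? z] = Some w -> z = a.
    by move=> z w /(fnd_joinP _ _ d); rewrite -e fnd_single; case: eqP.
  have xa := k x y (or_introl ex); have xa' := k x' y' (or_intror ex').
  by subst x x'; case: (d a); rewrite ?ex ?ex'.
Qed.

Lemma sat_szf h n : sat s h (szf n) <-> #|` domf h| = n.
Proof.
elim: n h => [|n IH] h; first by split=> /= [->|/eqP]; rewrite ?cardfs0 // cardfs_eq0 => /eqP.
split=> [[h1 [h2 [/djP d -> /sat_size1 [a [b e1]] /IH c2]]]|c].
- rewrite domf_cat e1 dom_setf /= fsetUC fsetU0 fsetUC cardfsU1 c2 /=.
  suff -> : a \notin domf h2 by [].
  by apply/notin_domf; case: (d a) => //; rewrite e1 fnd_single eqxx.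
- have /domf_neq0 [a [b e]] : domf h <> fset0 by move=> z; rewrite z cardfs0 in c.
  have sb : subh (single a b) h.
    by move=> x y; rewrite fnd_single; case: eqP => // -> [<-].
  have [d eh] := subh_split sb.
  exists (single a b), h.[\ domf (single a b)]; split=> //; first exact/djP.
  + by apply/sat_size1; exists a, b.
  + apply/IH; rewrite domf_rem dom_setf /= fsetU0.
    have k : a \in domf h by apply/in_domf; exists b.
    by have := cardfsD1 a (domf h); rewrite k c add1n => -[].
Qed.

Lemma is_path_card h n l : is_path h n l ->
  (forall i j, i <= n -> j <= n -> l i = l j -> i = j) -> #|` domf h| = n.
Proof.
move=> p inj; rewrite -[RHS](size_iota 0) -(size_map l); apply: perm_size.
apply: uniq_perm; rewrite ?fset_uniq //.
- rewrite map_inj_in_uniq ?iota_uniq // => i j; rewrite !mem_iota => /andP[_ i1] /andP[_ j1].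
  by apply: inj; exact: ltnW.
- move=> a; apply/idP/mapP => [/in_domf [b /p [i [lt -> _]]]|[i]].
  + by exists i; rewrite ?mem_iota.
  + by rewrite mem_iota => /andP [_ lt] ->; apply/in_domf; exists (l i.+1); apply/p; exists i.
Qed.

Lemma sat_path h n z x : 0 < n -> sat s h (pathf n z x) <->
  exists l : nat -> LOC, [/\ l 0 = s z, l n = s x,
    forall i j, i <= n -> j <= n -> l i = l j -> i = j
    & forall i, i < n -> h.[? l i] = Some (l i.+1)].
Proof.
move=> n0; split=> [/sat_sub [h' [sb [L /sat_szf c]]]|[l [l0 ln inj p]]].
- case: L => [[e _]|[m [l [m0 l0 lm inj p]]]].
    by rewrite -c e cardfs0 in n0.
  have em : m = n by rewrite -c (is_path_card p inj).
  subst m; exists l; split=> // i lt; apply: sb; apply/p; by exists i.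
- apply/sat_sub; pose r := [fset a in [seq l i | i <- iota 0 n]].
  have path : is_path h.[& r] n l.
    move=> a b; rewrite fnd_restrict !inE; split=> [|[i [lt -> ->]]].
    + case: ifP => // /mapP [i]; rewrite mem_iota => /andP [_ lt] ->.
      by rewrite p // => -[<-]; exists i.
    + by rewrite map_f ?mem_iota // p.
  exists h.[& r]; split; first by move=> a b; rewrite fnd_restrict; case: ifP.
  split; last by apply/sat_szf; exact: is_path_card inj.
  by right; exists n, l.
Qed.

Lemma sat_path2 h z x : sat s h (pathf 2 z x) <->
  exists a, [/\ h.[? s z] = Some a, h.[? a] = Some (s x), s z <> a, a <> s x & s z <> s x].
Proof.
rewrite sat_path //; split=> [[l [l0 ln inj p]]|[a [e1 e2 n1 n2 n3]]].
- exists (l 1); rewrite -l0 -ln; split; try exact: p;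
  by move=> /inj; lia.
- exists (fun i => if i is i'.+1 then if i' is 0 then a else s x else s z); split=> //.
  + by case=> [|[|[|i]]] [|[|[|j]]] //= _ _; intuition congruence.
  + by case=> [|[|i]].
Qed.

Lemma sat_path3 h z x : sat s h (pathf 3 z x) <->
  exists a b, [/\ h.[? s z] = Some a, h.[? a] = Some b, h.[? b] = Some (s x) &
    [/\ s z <> a, a <> b, b <> s x, s z <> b & [/\ s z <> s x & a <> s x]]].
Proof.
rewrite sat_path //; split=> [[l [l0 ln inj p]]|[a [b [e1 e2 e3 [n1 n2 n3 n4 [n5 n6]]]]]].
- exists (l 1), (l 2); rewrite -l0 -ln; split; try exact: p; do !split;
  by move=> /inj; lia.
- exists (fun i => match i with 0 => s z | 1 => a | 2 => b | _ => s x end); split=> //.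
  + by case=> [|[|[|[|i]]]] [|[|[|[|j]]]] //= _ _; intuition congruence.
  + by case=> [|[|[|i]]].
Qed.

End Sat.

(* Otherwise destructuring a hypothesis [sat s h p] unfolds it entirely. *)
Opaque sat.

(** * First-order quantification over locations *)

(* Variable 0 is a marker that no heap cell points to; variables 1, ..., 4 are
   the probes, a quantified location being stored as the target of a probe;
   variables 5, 6, ... are the colors, and a cell has color i when it points to
   the i-th of them. *)
Definition pvar (t : nat) : PVAR := t.+1.
Definition cvar (i : nat) : PVAR := 5 + i.

Section Probes.
Variable K : nat.

(** The guessed cell can only be that of probe [r], and its target avoids all [5 + K] variables, so
    that probing does not interfere with the marker, the colors or the other probes. *)
Definition exf r p :=
  septr (And size1 (And (alloc (pvar r))
          (conjf (5 + K) (fun w => Neg (PointsTo (pvar r) w))))) p.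
Definition allf r p := Neg (exf r (Neg p)).
Definition impf p q := orf (Neg p) q.
Definition colorf t i := pathf 2 (pvar t) (cvar i).
(** As no other cell points to the marker, only a cell from the probe's target to the marker can
    complete this path, and it can be added iff the target is unallocated. *)
Definition outf t := septr size1 (pathf 2 (pvar t) 0).
(* Deleting the cell at the target of probe u leaves room for a cell from there
   to the marker, which is then two steps away from the target of probe t. *)
Definition edgef t u :=
  subf (septr size1 (And (pathf 3 (pvar t) 0) (pathf 2 (pvar u) 0))).
(** The second conjunct keeps cells from pointing to the marker: a probe aimed at such a cell would
    be two steps away from it. *)
Definition goodf :=
  And (conjf (5 + K) (fun w => Neg (alloc w))) (Neg (exf 0 (pathf 2 (pvar 0) 0))).
(** A good heap has no cell at a variable. Hence a split leaves all probes in the right part, where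
    the evaluation continues, and an extension cannot collide with a probe. *)
Definition splf p q := Star (And goodf p) q.
Definition extf p q := septr (And goodf p) q.

Definition inj_store (s : store) :=
  forall v w, v < 5 + K -> w < 5 + K -> s v = s w -> v = w.

Variable s : store.
Hypothesis s_inj : inj_store s.
Implicit Type h : heap.

Definition nonres a := forall w, w < 5 + K -> a <> s w.
Definition good h := forall a b, h.[? a] = Some b -> nonres a /\ b <> s 0.
Definition okv (v : seq LOC) := size v <= 4 /\ forall a, a \in v -> nonres a.
(** Loops are left out because the locations on a path of [ls] are pairwise distinct. *)
Definition edge h a b := a <> b /\ h.[? a] = Some b.

(* [real h v] stores the quantified locations v in the probes, innermost first. *)
Fixpoint real h (v : seq LOC) :=
  if v is a :: w then (real h w + single (s (pvar (size w))) a)%fset else h.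

Lemma okv_nil : okv [::]. Proof. by []. Qed.

Lemma okv_cons a v : nonres a -> okv v -> size v < 4 -> okv (a :: v).
Proof. by move=> na [_ nv] lt; split=> // x; rewrite inE => /orP [/eqP ->|/nv]. Qed.

Lemma okv_nth v t : okv v -> t < size v -> nonres (nth 0 (rev v) t).
Proof. by move=> [_ nv] lt; apply: nv; rewrite -mem_rev mem_nth ?size_rev. Qed.

Lemma var_inj v w : v < 5 + K -> w < 5 + K -> v <> w -> s v <> s w.
Proof. by move=> v1 w1 n /(s_inj v1 w1). Qed.

Lemma pvar_inj t u : t < 4 -> u < 4 -> s (pvar t) = s (pvar u) -> t = u.
Proof.
move=> lt lu e; suff : t.+1 = u.+1 by case.
by apply: s_inj e; rewrite /pvar; lia.
Qed.

(** The location is classified once for all heaps [h], so that two heaps carrying the same probes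
    can be compared pointwise. *)
Lemma real_cases v x : size v <= 4 ->
  (exists t, [/\ t < size v, x = s (pvar t) &
      forall h, (real h v).[? x] = Some (nth 0 (rev v) t)]) \/
  ((forall t, t < size v -> x <> s (pvar t)) /\
      forall h, (real h v).[? x] = h.[? x]).
Proof.
elim: v => [|a v IH] lt; first by right.
case: (x =P s (pvar (size v))) => [->|n].
  left; exists (size v); split=> //= h.
  by rewrite fnd_join fnd_single eqxx rev_cons nth_rcons size_rev ltnn eqxx.
case: (IH (ltnW lt)) => [[t [lt1 e E]]|[n1 E]]; [left|right].
- exists t; split=> // [|h]; first exact: ltnW.
  by rewrite /= fnd_join fnd_single; case: eqP => // _; rewrite E rev_cons nth_rcons size_rev lt1.
- split=> [t /=|h]; first by rewrite ltnS leq_eqVlt => /orP [/eqP ->|/n1].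
  by rewrite /= fnd_join fnd_single; case: eqP.
Qed.

Lemma real_probe h v t : size v <= 4 -> t < size v ->
  (real h v).[? s (pvar t)] = Some (nth 0 (rev v) t).
Proof.
move=> lv lt; case: (real_cases (s (pvar t)) lv) => [[u [lu e ->]]|[n _]].
- by suff -> : t = u by []; apply: pvar_inj e; lia.
- by case: (n t).
Qed.

Lemma real_probe_out h v : good h -> size v < 4 -> (real h v).[? s (pvar (size v))] = None.
Proof.
move=> gh lv; case: (real_cases (s (pvar (size v))) (ltnW lv)) => [[u [lu e _]]|[n ->]].
- by have := pvar_inj _ _ e; lia.
- case e: h.[? _] => [b|] //; have [/(_ (pvar (size v))) n' _] := gh _ _ e.
  by case: n' => //; rewrite /pvar; lia.
Qed.

Lemma real_nonres h v x : nonres x -> size v <= 4 -> (real h v).[? x] = h.[? x].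
Proof.
move=> nx lv; case: (real_cases x lv) => [[u [lu e _]]|[n ->]] //.
by case: (nx (pvar u)) => //; rewrite /pvar; lia.
Qed.

(** The invariant on which [outf] and [edgef] rest: a cell to the marker must be a freshly added
    one. *)
Lemma real_marker h v x : good h -> okv v -> (real h v).[? x] <> Some (s 0).
Proof.
move=> gh ov; case: (real_cases x ov.1) => [[u [lu e ->]] [e0]|[n ->] /gh [_]] //.
exact: (okv_nth ov lu (w := 0)).
Qed.

Lemma subh_joinl h1 h2 : dj h1 h2 -> subh h1 (h1 + h2)%fset.
Proof. by move=> d a b e; apply/fnd_joinP; [|left]. Qed.

Lemma subh_joinr h1 h2 : subh h2 (h1 + h2)%fset.
Proof. by move=> a b e; rewrite fnd_join e. Qed.

Lemma good_sub h1 h2 : subh h1 h2 -> good h2 -> good h1.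
Proof. by move=> sb g a b /sb /g. Qed.

Lemma good_join h1 h2 : good h1 -> good h2 -> good (h1 + h2)%fset.
Proof. by move=> g1 g2 a b; rewrite fnd_join; case e: h2.[? a] => [c|] => [[<-]|/g1 //];
  exact: g2 e. Qed.

Lemma real_join h h' v : good h' -> size v <= 4 ->
  (real h v + h')%fset = real (h + h')%fset v.
Proof.
move=> g lv; apply/fmapP => x; rewrite fnd_join.
case: (real_cases x lv) => [[u [lu e E]]|[n E]]; rewrite !E; last by rewrite fnd_join.
case e': h'.[? x] => [b|] //; have [/(_ (pvar u)) [|//]] := g _ _ e'.
by rewrite /pvar; lia.
Qed.

Lemma dj_real h h' v : good h' -> size v <= 4 -> dj (real h v) h' <-> dj h h'.
Proof.
move=> g lv; split=> d x; case: (real_cases x lv) => [[u [lu e E]]|[n E]];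
  try by have := d x; rewrite E.
all: right; case e': h'.[? x] => [b|] //; have [/(_ (pvar u)) [|//]] := g _ _ e';
  by rewrite /pvar; lia.
Qed.

Lemma sat_ex h v p : good h -> okv v -> size v < 4 ->
  sat s (real h v) (exf (size v) p) <->
  exists a, nonres a /\ sat s (real h (a :: v)) p.
Proof.
move=> gh ov lv; rewrite /exf sat_septr; split=>
  [[h' [d /sat_and [/sat_size1 [a [b e]] /sat_and [/sat_alloc al /sat_conj nr]] p1]]|[a [na p1]]].
- exists b; subst h'.
  have ea : s (pvar (size v)) = a by move: al; rewrite fnd_single; case: eqP.
  subst a; split=> // w lw eb; move/sat_neg: (nr _ lw); apply; apply/sat_points.
  by rewrite fnd_single eqxx eb.
- exists (single (s (pvar (size v))) a); split=> //.
    by apply: dj_single; exact: real_probe_out.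
  apply/sat_and; split; first by apply/sat_size1; exists (s (pvar (size v))), a.
  apply/sat_and; split; first by apply/sat_alloc; rewrite fnd_single eqxx.
  by apply/sat_conj => w lw; apply/sat_neg => /sat_points; rewrite fnd_single eqxx => -[];
    exact: na.
Qed.

Lemma sat_all h v p : good h -> okv v -> size v < 4 ->
  sat s (real h v) (allf (size v) p) <->
  forall a, nonres a -> sat s (real h (a :: v)) p.
Proof.
move=> gh ov lv; rewrite /allf sat_neg sat_ex //.
split=> [n a na|A [a [na /sat_neg]]]; last by apply; exact: A.
by apply: NNPP => N; apply: n; exists a; split=> //; exact/sat_neg.
Qed.

Lemma sat_imp h p q : sat s h (impf p q) <-> (sat s h p -> sat s h q).
Proof. by rewrite sat_or sat_neg; split; [tauto|case: (classic (sat s h p)); tauto]. Qed.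

Lemma sat_color h v t i : okv v -> t < size v -> i < K ->
  sat s (real h v) (colorf t i) <-> h.[? nth 0 (rev v) t] = Some (s (cvar i)).
Proof.
move=> ov lt li; have nt := okv_nth ov lt; rewrite /colorf sat_path2 real_probe ?ov.1 //.
have lp : pvar t < 5 + K by case: (ov) => + _; rewrite /pvar; lia.
have lc : cvar i < 5 + K by rewrite /cvar; lia.
split=> [[a [[<-]]]|e]; first by rewrite real_nonres ?ov.1.
exists (nth 0 (rev v) t); rewrite real_nonres ?ov.1 //; split=> //.
- by move=> E; apply: (nt _ lp).
- exact: nt.
- by apply: var_inj => //; rewrite /pvar /cvar; case: (ov); lia.
Qed.

Lemma sat_out h v t : good h -> okv v -> t < size v ->
  sat s (real h v) (outf t) <-> h.[? nth 0 (rev v) t] = None.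
Proof.
move=> gh ov lt; have nt := okv_nth ov lt; rewrite /outf sat_septr.
have lp : pvar t < 5 + K by case: (ov) => + _; rewrite /pvar; lia.
set a := nth _ _ _ in nt *.
split=> [[h' [d /sat_size1 [x [y e]] /sat_path2 [b [e1 e2 n1 n2 n3]]]]|e].
- subst h'; move: e1 e2 => /fnd_joinP [] // + /fnd_joinP [] //.
  + by move=> _ /(real_marker gh ov).
  + rewrite real_probe ?ov.1 // => -[<-]; rewrite fnd_single; case: eqP => // e _.
    case: (d a); last by rewrite fnd_single /a e eqxx.
    by rewrite real_nonres ?ov.1.
  + by move=> _ /(real_marker gh ov).
  + by rewrite !fnd_single; case: eqP => // <- _; case: eqP => // /esym.
- exists (single a (s 0)); split.
  + by apply: dj_single; rewrite real_nonres ?ov.1.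
  + by apply/sat_size1; exists a, (s 0).
  + apply/sat_path2; exists a; rewrite !fnd_join !fnd_single eqxx.
    case: eqP => [E|E]; first by case: (nt _ lp).
    rewrite real_probe ?ov.1 //; split=> //; first exact: nt.
    by apply: var_inj.
Qed.

Lemma sat_edge h v t u : good h -> okv v -> t < size v -> u < size v ->
  sat s (real h v) (edgef t u) <-> edge h (nth 0 (rev v) t) (nth 0 (rev v) u).
Proof.
move=> gh ov lt lu; have nt := okv_nth ov lt; have nu := okv_nth ov lu.
have lp : pvar t < 5 + K by case: (ov) => + _; rewrite /pvar; lia.
have lq : pvar u < 5 + K by case: (ov) => + _; rewrite /pvar; lia.
rewrite /edgef sat_sub; set a := nth 0 (rev v) t in nt *.
set b := nth 0 (rev v) u in nu *.
split=> [[h1 [sb /sat_septr [h' [d /sat_size1 [x [y e]] /sat_and [/sat_path3 P /sat_path2 Q]]]]]|[n e]].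
- subst h'; case: P => a' [b' [/fnd_joinP - /(_ d) P1 /fnd_joinP - /(_ d) P2
     /fnd_joinP - /(_ d) P3 [m1 m2 m3 m4 [m5 m6]]]].
  case: Q => c [/fnd_joinP - /(_ d) Q1 /fnd_joinP - /(_ d) Q2 k1 k2 k3].
  (* Both paths end with the added cell, so they meet at [x]; all their other steps are old
     cells. *)
  have mark z : h1.[? z] = Some (s 0) \/ (single x y).[? z] = Some (s 0) -> z = x.
    case; first by move/sb/(real_marker gh ov).
    by rewrite fnd_single; case: eqP.
  have eb := mark _ P3; have ec := mark _ Q2; subst b' c.
  have old z w : z <> x -> h1.[? z] = Some w \/ (single x y).[? z] = Some w ->
      (real h v).[? z] = Some w.
    by move=> nz [/sb //|]; rewrite fnd_single; case: eqP.
  have := old _ _ m4 P1; rewrite real_probe ?ov.1 // => -[ea].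
  have := old _ _ k1 Q1; rewrite real_probe ?ov.1 // => -[eb].
  have := old _ _ m2 P2; rewrite /a /b ea eb -/a real_nonres ?ov.1 //.
  by rewrite -ea.
- exists (real h v).[~ b]; split.
    by move=> x y; rewrite fnd_rem1; case: eqP.
  apply/sat_septr; exists (single b (s 0)); split.
  + by apply: dj_single; rewrite fnd_rem1 eqxx.
  + by apply/sat_size1; exists b, (s 0).
  + have E z : z <> b -> ((real h v).[~ b] + single b (s 0))%fset.[? z] = (real h v).[? z].
      by move=> nz; rewrite fnd_join fnd_single fnd_rem1; case: eqP.
    have Eb : ((real h v).[~ b] + single b (s 0))%fset.[? b] = Some (s 0).
      by rewrite fnd_join fnd_single eqxx.
    have pb : s (pvar u) <> b by move=> e'; exact: (nu _ lq).
    have pb' : s (pvar t) <> b by move=> e'; exact: (nu _ lp).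
    have pa : s (pvar t) <> a by move=> e'; exact: (nt _ lp).
    have t0 : s (pvar t) <> s 0 by apply: var_inj.
    have u0 : s (pvar u) <> s 0 by apply: var_inj.
    have a0 : a <> s 0 by exact: nt.
    have b0 : b <> s 0 by exact: nu.
    apply/sat_and; split; [apply/sat_path3; exists a, b|apply/sat_path2; exists b];
      rewrite ?(E _ pb') ?(E _ pb) ?(E _ n) Eb real_probe ?ov.1 //.
    by split=> //; rewrite real_nonres ?ov.1.
Qed.

Lemma sat_good h : sat s h goodf <-> good h.
Proof.
split=> [/sat_and [/sat_conj A /sat_neg B] a b e|gh].
- have N x : h.[? x] <> None -> nonres x.
    by move=> nx w lw E; move/sat_neg: (A _ lw); apply; apply/sat_alloc; rewrite -E.
  have na : nonres a by apply: N; rewrite e.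
  split=> // E; apply: B; rewrite /exf sat_septr; exists (single (s (pvar 0)) a).
  have ne : h.[? s (pvar 0)] = None.
    by case e0: h.[? _] => [c|] //; case: (N (s (pvar 0)) _ (pvar 0)); rewrite ?e0.
  split; first exact: dj_single.
  + apply/sat_and; split; first by apply/sat_size1; exists (s (pvar 0)), a.
  apply/sat_and; split; first by apply/sat_alloc; rewrite fnd_single eqxx.
  by apply/sat_conj => w lw; apply/sat_neg => /sat_points; rewrite fnd_single eqxx => -[];
    exact: na.
  + apply/sat_path2; exists a; rewrite !fnd_join !fnd_single eqxx.
    case: eqP => [E'|n']; first by case: (na (pvar 0)).
    rewrite e E; split=> //; first by move=> /esym.
    * exact: na.
    * exact: var_inj.
- apply/sat_and; split; first by apply/sat_conj => w lw; apply/sat_neg => /sat_alloc;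
  case e: h.[? _] => [b|] // _;
    have [/(_ w lw)] := gh _ _ e.
  apply/sat_neg => /(sat_ex (v := [::]) _ gh okv_nil isT) [a [na /sat_path2 [b [_ e _ _ _]]]].
  by apply: (real_marker (v := [:: a]) gh _ e); exact: okv_cons.
Qed.

Lemma sat_ext h v p q : okv v ->
  sat s (real h v) (extf p q) <->
  exists h', [/\ good h', dj h h', sat s h' p & sat s (real (h + h')%fset v) q].
Proof.
move=> ov; rewrite /extf sat_septr;
  split=> [[h' [d /sat_and [/sat_good g p1] p2]]|[h' [g d p1 p2]]].
- by exists h'; split=> //; [apply/(dj_real _ g ov.1)|rewrite -real_join ?ov.1].
- by exists h'; rewrite real_join ?ov.1 //; split=> //; [apply/dj_real; case: ov|apply/sat_and;
  split=> //; exact/sat_good].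
Qed.

Lemma sat_spl h v p q : good h -> okv v ->
  sat s (real h v) (splf p q) <->
  exists h1 h2, [/\ dj h1 h2, h = (h1 + h2)%fset, sat s h1 p & sat s (real h2 v) q].
Proof.
move=> gh ov; rewrite /splf sat_star;
  split=> [[h1 [h2 [d E /sat_and [/sat_good g1 p1] p2]]]|[h1 [h2 [d E p1 p2]]]].
- have sb : subh h1 h.
    move=> a b e; rewrite -(real_nonres (v := v) _ (g1 _ _ e).1) ?ov.1 // E.
    exact: subh_joinl e.
  have [d' e'] := subh_split sb; exists h1, h.[\ domf h1]; split=> //.
  (* No probe cell lies in the good heap [h1], so the right part is the rest of [h] together with
     all probes. *)
  suff -> : real h.[\ domf h1] v = h2 by [].
  apply/fmapP => x; have := congr1 (fun k : heap => k.[? x]) E; rewrite /= fnd_join.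
  case: (real_cases x ov.1) => [[u [lu ex Ex]]|[n Ex]]; rewrite !Ex.
  + case: h2.[? x] => // e; have [/(_ (pvar u)) [|//]] := g1 _ _ (esym e).
    by case: (ov); rewrite /pvar; lia.
  + rewrite fnd_rem; case: ifP => [/in_domf [b e]|/negbT /notin_domf -> -> //];
    last by case: h2.[? x].
    by case: (d x) => [|->]; rewrite ?e.
- have g1 : good h1 by apply: good_sub gh; rewrite E; exact: subh_joinl.
  exists h1, (real h2 v); split=> //; last by apply/sat_and; split=> //; exact/sat_good.
  + apply: dj_sym; apply/dj_real => //; [by case: ov|exact: dj_sym].
  + rewrite E; apply/fmapP => x; rewrite fnd_join.
    case: (real_cases x ov.1) => [[u [lu ex Ex]]|[n Ex]]; rewrite !Ex //.
    by rewrite fnd_join.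
Qed.

End Probes.

(** * Properties of colors and edges expressed with at most four probes *)

Section Leaves.
Variables (K : nat) (s : store).
Hypothesis s_inj : inj_store K s.
Implicit Type h : heap.
Local Notation nonres := (nonres K s).
Local Notation good := (good K s).
Local Notation okv := (okv K s).
Local Notation real := (real s).
Local Notation exf := (exf K).
Local Notation allf := (allf K).
Local Notation X i := (s (cvar i)).

Lemma ok1 a : nonres a -> okv [:: a].
Proof. by move=> na; apply: okv_cons. Qed.

Lemma ok2 a b : nonres a -> nonres b -> okv [:: b; a].
Proof. by move=> na nb; apply: okv_cons (ok1 na) _. Qed.

Lemma ok3 a b c : nonres a -> nonres b -> nonres c -> okv [:: c; b; a].
Proof. by move=> na nb nc; apply: okv_cons (ok2 na nb) _. Qed.

Lemma ok4 a b c d : nonres a -> nonres b -> nonres c -> nonres d -> okv [:: d; c; b; a].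
Proof. by move=> na nb nc nd; apply: okv_cons (ok3 na nb nc) _. Qed.

Lemma nonres_color a i : nonres a -> i < K -> a <> X i.
Proof. by move=> na lt; apply: na; rewrite /cvar; lia. Qed.

Lemma good_dom h a b : good h -> h.[? a] = Some b -> nonres a.
Proof. by move=> g /g []. Qed.

Lemma sat_ex_color h i : good h -> i < K ->
  sat s h (exf 0 (colorf 0 i)) <-> exists a, h.[? a] = Some (X i).
Proof.
move=> gh li; rewrite (sat_ex s_inj (v := [::]) _ gh) //; split=> [[a [na]]|[a e]].
- by move/(sat_color s_inj h (ok1 na) (t := 0) isT li); exists a.
- exists a; have na := good_dom gh e; split=> //.
  exact/(sat_color s_inj h (ok1 na) (t := 0) isT li).
Qed.

Lemma sat_no_color h i : good h -> i < K ->
  sat s h (Neg (exf 0 (colorf 0 i))) <-> forall a, h.[? a] <> Some (X i).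
Proof.
move=> gh li; rewrite sat_neg sat_ex_color //; split=> [n a e|n [a]]; last exact: n.
by apply: n; exists a.
Qed.

Definition all_color i := allf 0 (impf (Neg (outf 0)) (colorf 0 i)).

Lemma sat_all_color h i : good h -> i < K ->
  sat s h (all_color i) <-> forall a b, h.[? a] = Some b -> b = X i.
Proof.
move=> gh li; rewrite (sat_all s_inj (v := [::]) _ gh) //; split=> [A a b e|A a na].
- have na := good_dom gh e; move: (A a na) => /sat_imp P.
  suff /P /(sat_color s_inj h (ok1 na) (t := 0) isT li) /= :
    sat s (real h [:: a]) (Neg (outf 0)) by rewrite e => -[].
  by apply/sat_neg => /(sat_out s_inj gh (ok1 na) (t := 0) isT); rewrite /= e.
- apply/sat_imp => /sat_neg n; apply/(sat_color s_inj h (ok1 na) (t := 0) isT li) => /=.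
  case e: h.[? a] => [b|]; first by rewrite (A _ _ e).
  by case: n; apply/(sat_out s_inj gh (ok1 na) (t := 0) isT).
Qed.

(** Imposed on a guessed map before it joins the heap: none of its targets is one of its sources. *)
Definition nochainf := allf 0 (impf (Neg (outf 0)) (exf 1 (And (edgef 0 1) (outf 1)))).
Definition nochain h := forall a b, h.[? a] = Some b -> [/\ nonres b, a <> b & h.[? b] = None].

Lemma sat_nochain h : good h -> sat s h nochainf <-> nochain h.
Proof.
move=> gh; rewrite (sat_all s_inj (v := [::]) _ gh) //; split=> [A a b e|A a na].
- have na := good_dom gh e; move: (A a na) => /sat_imp P.
  have /P /(sat_ex s_inj (v := [:: a]) _ gh (ok1 na) isT) [b' [nb' ]] :
      sat s (real h [:: a]) (Neg (outf 0)).
    by apply/sat_neg => /(sat_out s_inj gh (ok1 na) (t := 0) isT); rewrite /= e.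
  move=> /sat_and [/(sat_edge s_inj gh (ok2 na nb') (t := 0) (u := 1) isT isT) [/= n]].
  by rewrite e => -[->] /(sat_out s_inj gh (ok2 na nb') (t := 1) isT).
- apply/sat_imp => /sat_neg n; apply/(sat_ex s_inj (v := [:: a]) _ gh (ok1 na)) => //.
  case e: h.[? a] => [b|].
    have [nb nab eb] := A _ _ e; exists b; split=> //; apply/sat_and; split.
    + by apply/(sat_edge s_inj gh (ok2 na nb) (t := 0) (u := 1) isT isT).
    + by apply/(sat_out s_inj gh (ok2 na nb) (t := 1) isT).
  by case: n; apply/(sat_out s_inj gh (ok1 na) (t := 0) isT).
Qed.

Lemma sat_all_edge h p : good h -> sat s h (allf 0 (allf 1 (impf (edgef 0 1) p))) <->
  forall a b, nonres b -> edge h a b -> sat s (real h [:: b; a]) p.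
Proof.
move=> gh; rewrite (sat_all s_inj (v := [::]) _ gh) //; split=> [A a b nb E|A a na].
- have na := good_dom gh E.2; move: (A a na) => /(sat_all s_inj (v := [:: a]) _ gh (ok1 na) isT).
  move=> /(_ _ nb) /sat_imp; apply.
  exact/(sat_edge s_inj gh (ok2 na nb) (t := 0) (u := 1) isT isT).
- apply/(sat_all s_inj (v := [:: a]) _ gh (ok1 na) isT) => b nb; apply/sat_imp.
  by move=> /(sat_edge s_inj gh (ok2 na nb) (t := 0) (u := 1) isT isT); exact: A.
Qed.

(** Once the rest of the heap has no edge into [c], splitting off such a heap isolates the fiber
    over [c]. *)
Definition common_target := exf 0 (allf 1 (impf (Neg (outf 1)) (edgef 1 0))).

Lemma sat_common_target h : good h -> sat s h common_target <->
  exists b, nonres b /\ forall a b', h.[? a] = Some b' -> b' = b /\ a <> b.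
Proof.
move=> gh; rewrite (sat_ex s_inj (v := [::]) _ gh) //.
split=> -[b [nb]] => [/(sat_all s_inj (v := [:: b]) _ gh (ok1 nb) isT)|] A; exists b; split=> //.
- move=> a b' e; have na := good_dom gh e; move: (A a na) => /sat_imp P.
  have /P /(sat_edge s_inj gh (ok2 nb na) (t := 1) (u := 0) isT isT) [/= n] :
      sat s (real h [:: a; b]) (Neg (outf 1)).
    by apply/sat_neg => /(sat_out s_inj gh (ok2 nb na) (t := 1) isT); rewrite /= e.
  by rewrite e => -[].
- apply/(sat_all s_inj (v := [:: b]) _ gh (ok1 nb) isT) => a na; apply/sat_imp => /sat_neg n.
  apply/(sat_edge s_inj gh (ok2 nb na) (t := 1) (u := 0) isT isT) => /=.
  case e: h.[? a] => [b'|]; first by have [eb ne] := A _ _ e; rewrite eb in e.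
  by case: n; apply/(sat_out s_inj gh (ok2 nb na) (t := 1) isT).
Qed.

Lemma sat_pred h c : good h -> nonres c ->
  sat s (real h [:: c]) (exf 1 (edgef 1 0)) <-> exists e, edge h e c.
Proof.
move=> gh nc; rewrite (sat_ex s_inj (v := [:: c]) _ gh (ok1 nc)) //.
split=> [[e [ne]]|[e E]].
- by move/(sat_edge s_inj gh (ok2 nc ne) (t := 1) (u := 0) isT isT); exists e.
- have ne := good_dom gh E.2; exists e; split=> //.
  exact/(sat_edge s_inj gh (ok2 nc ne) (t := 1) (u := 0) isT isT).
Qed.

(** The additional edge into the middle location is what identifies that location as a cell of color
    [k] in [prod_sound]. *)
Definition all_reached j :=
  allf 1 (impf (colorf 1 j) (exf 2 (exf 3 (And (edgef 3 2) (edgef 2 1))))).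

Lemma sat_all_reached h c j : good h -> nonres c -> j < K ->
  sat s (real h [:: c]) (all_reached j) <->
  forall d, h.[? d] = Some (X j) -> exists e g, edge h g e /\ edge h e d.
Proof.
move=> gh nc lj; rewrite (sat_all s_inj (v := [:: c]) _ gh (ok1 nc)) //.
split=> [A d e|A d nd].
- have nd := good_dom gh e; move: (A d nd) => /sat_imp P.
  have /P : sat s (real h [:: d; c]) (colorf 1 j).
    exact/(sat_color s_inj h (ok2 nc nd) (t := 1) isT lj).
  move=> /(sat_ex s_inj (v := [:: d; c]) _ gh (ok2 nc nd) isT) [x [nx]].
  move=> /(sat_ex s_inj (v := [:: x; d; c]) _ gh (ok3 nc nd nx) isT) [y [ny]].
  move=> /sat_and [/(sat_edge s_inj gh (ok4 nc nd nx ny) (t := 3) (u := 2) isT isT) E1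
    /(sat_edge s_inj gh (ok4 nc nd nx ny) (t := 2) (u := 1) isT isT) E2].
  by exists x, y.
- apply/sat_imp => /(sat_color s_inj h (ok2 nc nd) (t := 1) isT lj) /A [x [y [E1 E2]]].
  have nx := good_dom gh E2.2; have ny := good_dom gh E1.2.
  apply/(sat_ex s_inj (v := [:: d; c]) _ gh (ok2 nc nd) isT); exists x; split=> //.
  apply/(sat_ex s_inj (v := [:: x; d; c]) _ gh (ok3 nc nd nx) isT); exists y; split=> //.
  apply/sat_and; split.
  + exact/(sat_edge s_inj gh (ok4 nc nd nx ny) (t := 3) (u := 2) isT isT).
  + exact/(sat_edge s_inj gh (ok4 nc nd nx ny) (t := 2) (u := 1) isT isT).
Qed.

End Leaves.

(** * Multiplication of color counts *)

Definition cells (s : store) (h : heap) i :=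
  [seq a <- domf h | h.[? a] == Some (s (cvar i))].

Lemma mem_cells s h i a : (a \in cells s h i) = (h.[? a] == Some (s (cvar i))).
Proof.
rewrite mem_filter; case: eqP => //= e.
by apply/in_domf; exists (s (cvar i)).
Qed.

Lemma cells_uniq s h i : uniq (cells s h i).
Proof. by rewrite filter_uniq ?fset_uniq. Qed.

(** Double counting: each [e] lies in at most one fiber. The option type lets [f] be the lookup in a
    heap. *)
Lemma fiber_count (T : eqType) (cs es : seq T) (f : T -> option T) q : uniq cs ->
  (forall c, c \in cs -> q <= count (fun e => f e == Some c) es) ->
  size cs * q <= size es.
Proof.
move=> uc le; rewrite -sum1_size big_distrl /=.
apply: (@leq_trans (\sum_(c <- cs) count (fun e => f e == Some c) es)).
  by rewrite big_seq [X in _ <= X]big_seq; apply: leq_sum => c /le; rewrite mul1n.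
under eq_bigr do rewrite -sum1_count big_mkcond.
rewrite exchange_big /= -[X in _ <= X]sum1_size; apply: leq_sum => e _.
rewrite -big_mkcond sum1_count; case: (f e) => [x|]; last by rewrite count_pred0.
by rewrite (eq_count (a2 := pred1 x)) ?count_uniq_mem //; case: (x \in cs).
Qed.

Section Product.
Variables (K : nat) (s : store).
Hypothesis s_inj : inj_store K s.
Implicit Type h : heap.
Local Notation nonres := (nonres K s).
Local Notation good := (good K s).
Local Notation real := (real s).
Local Notation exf := (exf K).
Local Notation allf := (allf K).
Local Notation X i := (s (cvar i)).

Lemma sat_ext0 h p q : sat s h (extf K p q) <->
  exists h', [/\ good h', dj h h', sat s h' p & sat s (h + h')%fset q].
Proof. exact: (sat_ext s_inj (v := [::]) _ _ _ (okv_nil _ _)). Qed.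

Lemma sat_spl0 h p q : good h -> sat s h (splf K p q) <->
  exists h1 h2, [/\ dj h1 h2, h = (h1 + h2)%fset, sat s h1 p & sat s h2 q].
Proof. move=> gh; exact: (sat_spl s_inj (v := [::]) _ _ gh (okv_nil _ _)). Qed.

Lemma cvar_inj i j : i < K -> j < K -> X i = X j -> i = j.
Proof. by move=> li lj /s_inj; rewrite /cvar; lia. Qed.

(* With C, D, E the sets of cells of color i, j, k: G adds a cell pointing to each
   element of E, so that E is still known once its own cells are deleted; F then
   maps E to C, and for each c in C the fiber of c is mapped onto D by F'.  The
   cells added by F and F' do not point to each other, hence their sources are
   elements of E, and the map e |-> (F e, F' e) witnesses #|C| * #|D| <= #|E|. *)
Definition prodf i j k :=
  And (exf 0 (colorf 0 i)) (And (exf 0 (colorf 0 j))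
  (extf K (Neg (exf 0 (colorf 0 k)))
    (And (allf 0 (allf 1 (impf (edgef 0 1) (colorf 1 k))))
    (splf K (all_color K k)
      (extf K (nochainf K)
        (And (allf 0 (allf 1 (impf (edgef 0 1) (And (Neg (outf 1)) (Neg (colorf 1 j))))))
        (allf 0 (impf (colorf 0 i)
          (And (exf 1 (edgef 1 0))
          (splf K (common_target K)
            (And (Neg (exf 1 (edgef 1 0)))
            (extf K (nochainf K) (all_reached K j))))))))))))).

Definition colored h := forall a b, h.[? a] = Some b -> exists2 i, i < K & b = X i.

Lemma prod_sound h i j k : i < K -> j < K -> k < K -> i <> k -> j <> k ->
  good h -> colored h -> sat s h (prodf i j k) ->
  [/\ 0 < size (cells s h i), 0 < size (cells s h j)
    & size (cells s h i) * size (cells s h j) <= size (cells s h k)].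
Proof.
move=> li lj lk ik jk gh ch /sat_and [/(sat_ex_color s_inj gh li) [c0 ec0]].
move=> /sat_and [/(sat_ex_color s_inj gh lj) [d0 ed0]].
move=> /sat_ext0 [G [gG dG /(sat_no_color s_inj gG lk) nG /sat_and []]].
have g1 := good_join gh gG; set H1 := (h + G)%fset in g1 *.
move=> /(sat_all_edge s_inj _ g1) E1 /(sat_spl0 _ _ g1) [E' [H2 [dE eH1]]].
have g2 : good H2 by apply: good_sub g1; rewrite eH1; exact: subh_joinr.
have gE : good E' by apply: good_sub g1; rewrite eH1; exact: subh_joinl.
move=> /(sat_all_color s_inj gE lk) cE /sat_ext0 [F [gF dF /(sat_nochain s_inj gF) nF]].
have g3 := good_join g2 gF; set H3 := (H2 + F)%fset in g3 *.
move=> /sat_and [/(sat_all_edge s_inj _ g3) E3 A4].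
have X0 : 0 < size (cells s h i) by rewrite -has_predT; apply/hasP; exists c0;
  rewrite ?mem_cells ?ec0.
have Y0 : 0 < size (cells s h j) by rewrite -has_predT; apply/hasP; exists d0;
  rewrite ?mem_cells ?ed0.
split=> //; apply: (@fiber_count _ _ _ (fun e => H3.[? e])); first exact: cells_uniq.
have H12 a b : H2.[? a] = Some b -> H1.[? a] = Some b by rewrite eH1; exact: subh_joinr.
have keep a l : l < K -> l <> k -> h.[? a] = Some (X l) -> H2.[? a] = Some (X l).
  move=> ll nl e; have : H1.[? a] = Some (X l) by apply: subh_joinl.
  by rewrite eH1 => /(fnd_joinP _ _ dE) [/cE /cvar_inj - /(_ ll lk)|].
have H23 : subh H2 H3 by exact: subh_joinl.
have col1 a b : nonres b -> edge H1 a b -> h.[? b] = Some (X k).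
  move=> nb E; have na := good_dom g1 E.2.
  move: (E1 a b nb E) => /(sat_color s_inj _ (ok2 na nb) (t := 1) isT lk) /=.
  by move=> /(fnd_joinP _ _ dG) [//|/nG].
have edge3 a b : nonres b -> edge H3 a b -> H3.[? b] <> None /\ H3.[? b] <> Some (X j).
  move=> nb E; have na := good_dom g3 E.2; move: (E3 a b nb E) => /sat_and [].
  move=> /sat_neg n1 /sat_neg n2; split=> N.
  - by apply: n1; apply/(sat_out s_inj g3 (ok2 na nb) (t := 1) isT).
  - by apply: n2; apply/(sat_color s_inj _ (ok2 na nb) (t := 1) isT lj).
move=> c; rewrite mem_cells => /eqP ec; have nc := good_dom gh ec.
have ec3 := H23 _ _ (keep _ _ li ik ec).
move: A4 => /(sat_all s_inj (v := [::]) _ g3 (okv_nil _ _) isT) /(_ _ nc) /sat_imp P.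
have /P /sat_and [/(sat_pred s_inj g3 nc) [e0 Ee0]] : sat s (real H3 [:: c]) (colorf 0 i).
  exact/(sat_color s_inj _ (ok1 nc) (t := 0) isT li).
move=> /(sat_spl s_inj _ _ g3 (ok1 nc)) [H5 [H4 [d5 e3]]].
have g5 : good H5 by apply: good_sub g3; rewrite e3; exact: subh_joinl.
have g4 : good H4 by apply: good_sub g3; rewrite e3; exact: subh_joinr.
have H34 a b : H3.[? a] = Some b <-> H5.[? a] = Some b \/ H4.[? a] = Some b.
  by rewrite e3; exact: fnd_joinP.
move=> /(sat_common_target s_inj g5) [b [nb B]] /sat_and [/sat_neg N4].
move=> /(sat_ext s_inj _ _ _ (ok1 nc)) [F' [gF' dF' /(sat_nochain s_inj gF') nF']].
have g4' := good_join g4 gF'; move=> /(sat_all_reached s_inj g4' nc lj) R.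
have {N4} N4 e : ~ edge H4 e c by move=> E; apply: N4; apply/(sat_pred s_inj g4 nc); exists e.
(* The predecessor [e0] of [c] is no longer one in [H4], so its cell is in [H5] and the common
   target is [c]. *)
have fib a b' : H5.[? a] = Some b' -> b' = c.
  suff <- : b = c by move=> /B [].
  move: (Ee0) => [n0 /H34 [/B [] //|e]]; by case: (N4 e0).
(* Take [g -> e -> d] from [R]. The second cell is new, because edges of [H3] avoid targets of color
   [j]; so [e] is a source of [F'], free in [H4]. By [nF'] the first cell is old, so [e] is
   allocated in [H3], hence in the fiber [H5]. *)
have key d : h.[? d] = Some (X j) -> exists e,
    [/\ h.[? e] = Some (X k), H3.[? e] = Some c & F'.[? e] = Some d].
  move=> ed; have nd := good_dom gh ed.
  have ed3 := H23 _ _ (keep _ _ lj jk ed).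
  have ed4 : (H4 + F')%fset.[? d] = Some (X j).
    apply/(fnd_joinP _ _ dF'); left; case/H34: (ed3) => // /fib /esym.
    by move/(nonres_color nc).
  have [e [g [Ege Eed]]] := R _ ed4.
  have Fe : F'.[? e] = Some d.
    case/(fnd_joinP _ _ dF'): (Eed.2) => // e4.
    have [] := edge3 e d nd _; last by rewrite ed3.
    by split; [exact: Eed.1|apply/H34; right].
  have ne := good_dom gF' Fe.
  have e4 : H4.[? e] = None by case: (dF' e) => //; rewrite Fe.
  have g4e : H4.[? g] = Some e.
    case/(fnd_joinP _ _ dF'): (Ege.2) => // /nF' [_ _]; by rewrite Fe.
  have Eg3 : edge H3 g e by split; [exact: Ege.1|apply/H34; right].
  have e3c : H3.[? e] = Some c.
    have [+ _] := edge3 g e ne Eg3; case E: H3.[? e] => [x|] // _.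
    by case/H34: (E) => [/fib ->|]; rewrite ?e4.
  exists e; split=> //.
  (* If [g -> e] belonged to [F], then [e] would not be a source of [F], and [e -> c] would be an
     edge of [H1] into [c], whose color is [i] and not [k]. *)
  case/(fnd_joinP _ _ dF): (Eg3.2) => [g2e|gFe].
    by apply: col1 ne _; split; [exact: Ege.1|exact: H12].
  have [_ _ Fe0] := nF _ _ gFe.
  case/(fnd_joinP _ _ dF): (e3c) => [e2|]; last by rewrite Fe0.
  have E : edge H1 e c.
    split; last exact: H12.
    by move=> E; move: e3c; rewrite E ec3 => -[/esym /(nonres_color nc li)].
  by have := col1 e c nc E; rewrite ec => -[/(cvar_inj li lk)].
(* [F'] maps the fiber of [c] onto the cells of color [j]; the witnesses from [key] are in its
   domain, so the default 0 is harmless. *)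
rewrite -size_filter -[leqRHS](size_map (fun e => odflt 0 F'.[? e])).
apply: uniq_leq_size; first exact: cells_uniq.
move=> d; rewrite mem_cells => /eqP /key [e [ek e3c Fe]]; apply/mapP; exists e; last by rewrite Fe.
by rewrite mem_filter e3c mem_cells ek !eqxx.
Qed.

Lemma nonres_bound : exists B, forall a, B <= a -> nonres a.
Proof.
exists (\max_(w < 5 + K) s w).+1 => a le w lw E.
by have := leq_bigmax (Ordinal lw) (F := fun w : 'I_(5 + K) => s w); rewrite /= -E leqNgt le.
Qed.

Lemma prod_complete h i j k : i < K -> j < K -> k < K -> i <> k -> j <> k -> i <> j ->
  good h -> colored h -> 0 < size (cells s h i) -> 0 < size (cells s h j) ->
  size (cells s h i) * size (cells s h j) <= size (cells s h k) ->
  sat s h (prodf i j k).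
Proof.
move=> li lj lk ik jk ij gh ch; set cs := cells s h i; set ds := cells s h j.
set es := cells s h k; set p := size cs; set q := size ds => p0 q0 le.
have csP a : (a \in cs) = (h.[? a] == Some (X i)) by exact: mem_cells.
have dsP a : (a \in ds) = (h.[? a] == Some (X j)) by exact: mem_cells.
have esP a : (a \in es) = (h.[? a] == Some (X k)) by exact: mem_cells.
have csn a : a \in cs -> nonres a by rewrite csP => /eqP /(good_dom gh).
have dsn a : a \in ds -> nonres a by rewrite dsP => /eqP /(good_dom gh).
have esn a : a \in es -> nonres a by rewrite esP => /eqP /(good_dom gh).
have ces a : a \in cs -> a \notin es.
  by rewrite csP esP => /eqP ->; apply/eqP => -[/(cvar_inj li lk)].
have des a : a \in ds -> a \notin es.
  by rewrite dsP esP => /eqP ->; apply/eqP => -[/(cvar_inj lj lk)].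
have hn a b : h.[? a] = Some b -> ~ nonres b by move=> /ch [l ll ->] /nonres_color /(_ ll).
have n0 a : nonres a -> a <> s 0 by apply.
have [B1 hB1] := heap_bound h; have [B2 hB2] := nonres_bound.
pose B := (B1 + B2).+1.
have hB a : B <= a -> h.[? a] = None by move=> l; apply: hB1; lia.
have nB a : B <= a -> nonres a by move=> l; apply: hB2; lia.
have esB a : a \in es -> a < B.
  by rewrite esP ltnNge => /eqP e; apply/negP => /hB; rewrite e.
apply/sat_and; split.
  by apply/(sat_ex_color s_inj gh li); exists (nth 0 cs 0); apply/eqP; rewrite -csP mem_nth.
apply/sat_and; split.
  by apply/(sat_ex_color s_inj gh lj); exists (nth 0 ds 0); apply/eqP; rewrite -dsP mem_nth.
(* Shifting by the bound [B] puts the sources of [G] outside [h] and the variables. *)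
pose G := mkheap [seq B + e | e <- es] (fun g => g - B).
have GP a b : G.[? a] = Some b <-> b \in es /\ a = B + b.
  rewrite fnd_mkheap; case: ifP => [/mapP [e ee ->]|/negP n].
    by rewrite addKn; split=> [[<-]|[_ /addnI ->]].
  by split=> // -[eb eab]; case: n; rewrite eab map_f.
have gG : good G.
  move=> a b /GP [eb ->]; split; [by apply: nB; exact: leq_addr|exact/n0/esn].
have dG : dj h G.
  move=> a; case e: G.[? a] => [b|]; last by right.
  by left; apply: hB; move/GP: e => [_ ->]; exact: leq_addr.
apply/sat_ext0; exists G; split=> //.
  apply/(sat_no_color s_inj gG lk) => a /GP [eb _]; exact: (nonres_color (esn _ eb) lk).
have g1 := good_join gh gG; set H1 := (h + G)%fset in g1 *.
have H1P a b : H1.[? a] = Some b <-> h.[? a] = Some b \/ G.[? a] = Some b by exact: fnd_joinP.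
apply/sat_and; split.
  apply/(sat_all_edge s_inj _ g1) => a b nb E; have na := good_dom g1 E.2.
  apply/(sat_color s_inj _ (ok2 na nb) (t := 1) isT lk) => /=.
  case/H1P: E.2 => [/hn //|/GP [eb _]].
  by apply/H1P; left; apply/eqP; rewrite -esP.
pose E' := mkheap es (fun _ => X k).
have sE : subh E' H1.
  move=> a b; rewrite fnd_mkheap; case: ifP => // ea [<-].
  by apply/H1P; left; apply/eqP; rewrite -esP.
have E'P a : a \in domf E' = (a \in es).
  apply/idP/idP => [/in_domf [b]|ea]; first by rewrite fnd_mkheap; case: ifP.
  by apply/in_domf; exists (X k); rewrite fnd_mkheap ea.
have [dE eH1] := subh_split sE; set H2 := H1.[\ domf E'] in dE eH1.
have gE : good E' by exact: good_sub sE g1.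
have H2P a b : H2.[? a] = Some b <-> H1.[? a] = Some b /\ a \notin es.
  by rewrite fnd_rem E'P; case: (a \in es); split=> // -[].
have g2 : good H2 by move=> a b /H2P [/g1].
apply/(sat_spl0 _ _ g1); exists E', H2; split=> //.
  by apply/(sat_all_color s_inj gE lk) => a b; rewrite fnd_mkheap; case: ifP => // _ [].
(* Element number [r + p * t] of [es] goes to element number [r] of [cs]; since [p * q <= size es],
   every [r < p] is reached for all [t < q]. Below, [F'] sends that element to number [t] of
   [ds]. *)
pose f e := nth 0 cs (index e es %% p).
have fcs e : f e \in cs by apply: mem_nth; rewrite ltn_mod.
pose F := mkheap es f.
have FP a b : F.[? a] = Some b <-> a \in es /\ b = f a.
  by rewrite fnd_mkheap; case: ifP => ea; [split=> [[<-]|[_ ->]]|split=> // -[]].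
have gF : good F by move=> a b /FP [ea ->]; split; [exact: esn|exact/n0/csn].
have dF : dj H2 F.
  move=> a; rewrite fnd_rem E'P fnd_mkheap; by case: ifP; [left|right].
apply/sat_ext0; exists F; split=> //.
  apply/(sat_nochain s_inj gF) => a b /FP [ea ->]; split; first exact/csn.
  - by move=> E; have := ces _ (fcs a); rewrite -E ea.
  - by rewrite fnd_mkheap (negbTE (ces _ (fcs a))).
have g3 := good_join g2 gF; set H3 := (H2 + F)%fset in g3 *.
have H3P a b : H3.[? a] = Some b <->
    [\/ h.[? a] = Some b /\ a \notin es, b \in es /\ a = B + b | a \in es /\ b = f a].
  rewrite (fnd_joinP _ _ dF) FP H2P H1P GP; split.
    by case=> [[[H|H] n]|H]; [apply: Or31|apply: Or32|apply: Or33].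
  case=> [[H n]|[eb eab]|H]; [by left; split; [left|]| |by right].
  left; split; first by right.
  by rewrite eab; apply/negP => /esB; lia.
apply/sat_and; split.
  apply/(sat_all_edge s_inj _ g3) => a b nb E; have na := good_dom g3 E.2.
  suff : exists x, H3.[? b] = Some x /\ x <> X j.
    move=> [x [ex nx]]; apply/sat_and; split; apply/sat_neg.
    - by move=> /(sat_out s_inj g3 (ok2 na nb) (t := 1) isT); rewrite /= ex.
    - by move=> /(sat_color s_inj _ (ok2 na nb) (t := 1) isT lj); rewrite /= ex => -[].
  case/H3P: E.2 => [[/hn] //|[eb _]|[ea eb]].
  - exists (f b); split; last exact: nonres_color (csn _ (fcs b)) lj.
    by apply/H3P; apply: Or33.
  - exists (X i); split; last by move/(cvar_inj li lj).
    by apply/H3P; apply: Or31; rewrite eb ces //; split=> //; apply/eqP; rewrite -csP.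
apply/(sat_all s_inj (v := [::]) _ g3 (okv_nil _ _) isT) => c nc; apply/sat_imp.
move=> /(sat_color s_inj _ (ok1 nc) (t := 0) isT li) /= ec.
have {ec} cc : c \in cs.
  case/H3P: ec => [[e _]|[eb _]|[_ eb]]; first by rewrite csP e.
  - by case: (nonres_color (esn _ eb) li).
  - by case: (nonres_color (csn _ (fcs c)) li).
pose r := index c cs; have rp : r < p by rewrite index_mem.
pose e_ t := nth 0 es (r + p * t).
have ltr t : t < q -> r + p * t < size es.
  by move=> lt; apply: leq_trans le; apply: (@leq_trans (p * t.+1));
    [lia|rewrite leq_mul2l lt orbT].
have eE t : t < q -> e_ t \in es by move=> /ltr; exact: mem_nth.
have eI t : t < q -> index (e_ t) es = r + p * t.
  by move=> /ltr lt; rewrite index_uniq // cells_uniq.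
have ef t : t < q -> f (e_ t) = c.
  by move=> lt; rewrite /f eI // addnC mulnC modnMDl modn_small // nth_index.
apply/sat_and; split.
  apply/(sat_pred s_inj g3 nc); exists (e_ 0); split.
    by move=> E; have := ces _ cc; rewrite -E eE.
  by apply/H3P; apply: Or33; rewrite eE // ef.
(* The whole fiber is removed, which may exceed the [q] elements [e_ t], because no edge into [c]
   may remain. *)
pose H5 := mkheap [seq e <- es | f e == c] (fun _ => c).
have H5P a b : H5.[? a] = Some b <-> [/\ a \in es, f a = c & b = c].
  rewrite fnd_mkheap mem_filter; case: eqP => [fa|n] /=; last by split=> // -[].
  by case: ifP => ea; [split=> [[<-]|[_ _ ->]]|split=> // -[]].
have s5 : subh H5 H3.
  by move=> a b /H5P [ea fa ->]; apply/H3P; apply: Or33.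
have [d5 e3] := subh_split s5; set H4 := H3.[\ domf H5] in d5 e3.
have g5 : good H5 by exact: good_sub s5 g3.
have H4P a b : H4.[? a] = Some b <-> H3.[? a] = Some b /\ ~ (a \in es /\ f a = c).
  rewrite fnd_rem; case: ifP => [/in_domf [x /H5P [ea fa _]]|/negP n].
    by split=> // -[_ []].
  split=> [->|[] //]; split=> // -[ea fa]; apply: n; apply/in_domf.
  by exists c; apply/H5P.
have g4 : good H4 by move=> a b /H4P [/g3].
apply/(sat_spl s_inj _ _ g3 (ok1 nc)); exists H5, H4; split=> //.
  apply/(sat_common_target s_inj g5); exists c; split=> // a b /H5P [ea _ ->]; split=> // E.
  by have := ces _ cc; rewrite -E ea.
apply/sat_and; split.
  apply/sat_neg => /(sat_pred s_inj g4 nc) [e [_ /H4P [/H3P + n]]].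
  case=> [[/hn] //|[ce _]|[ee fe]]; first by have := ces _ cc; rewrite ce.
  by apply: n.
pose F' := mkheap [seq e_ t | t <- iota 0 q] (fun e => nth 0 ds (index e es %/ p)).
have F'P a b : F'.[? a] = Some b <-> exists t, [/\ t < q, a = e_ t & b = nth 0 ds t].
  have dv t : t < q -> index (e_ t) es %/ p = t.
    by move=> lt; rewrite eI // addnC mulnC divnMDl // divn_small // addn0.
  rewrite fnd_mkheap; case: ifP => [/mapP [t]|/negP n].
    rewrite mem_iota => /andP [_ lt] ->; rewrite dv //; split=> [[<-]|[u [lu eu ->]]].
      by exists t.
    by rewrite -(dv t lt) eu dv.
  by split=> // -[t [lt ea _]]; case: n; rewrite ea; apply: map_f; rewrite mem_iota add0n lt.
have dsI t : t < q -> nth 0 ds t \in ds by exact: mem_nth.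
have gF' : good F'.
  by move=> a b /F'P [t [lt -> ->]]; split; [exact/esn/eE|exact/n0/dsn/dsI].
have dF' : dj H4 F'.
  move=> a; case e: F'.[? a] => [b|]; last by right.
  left; case e4: H4.[? a] => [x|] //; case/H4P: e4 => _ []; move/F'P: e => [t [lt -> _]].
  by split; [exact: eE|exact: ef].
apply/(sat_ext s_inj _ _ _ (ok1 nc)); exists F'; split=> //.
  apply/(sat_nochain s_inj gF') => a b /F'P [t [lt -> ->]]; split; first exact/dsn/dsI.
  - by move=> E; have := des _ (dsI _ lt); rewrite -E eE.
  - case e: F'.[? _] => [x|] //; move/F'P: e => [u [lu eu _]].
    by have := des _ (dsI _ lt); rewrite eu eE.
apply/(sat_all_reached s_inj (good_join g4 gF') nc lj) => d ed.
have dd : d \in ds.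
  case/(fnd_joinP _ _ dF'): ed => [/H4P [/H3P + _]|/F'P [t [lt _ eX]]].
  - case=> [[e _]|[eb _]|[_ eb]]; first by rewrite dsP e.
    + by case: (nonres_color (esn _ eb) lj).
    + by case: (nonres_color (csn _ (fcs d)) lj).
  - by case: (nonres_color (dsn _ (dsI _ lt)) lj).
have ltd : index d ds < q by rewrite index_mem.
(* The second witness is the cell of [G] pointing to the first. *)
exists (e_ (index d ds)), (B + e_ (index d ds)); split; split.
- by rewrite /B; lia.
- apply/(fnd_joinP _ _ dF'); left; apply/H4P; split.
    by apply/H3P; apply: Or32; rewrite eE.
  by move=> [/esB + _]; lia.
- by move=> E; have := des _ dd; rewrite -E eE.
- apply/(fnd_joinP _ _ dF'); right; apply/F'P; exists (index d ds).
  by rewrite nth_index.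
Qed.

End Product.

(** * Definable arithmetic predicates *)

Implicit Types (s : store) (h : heap).

Definition upd (e : nat -> nat) i a : nat -> nat := fun j => if j == i then a else e j.

Definition numeric K s (e : nat -> nat) h :=
  [/\ good K s h, colored K s h & forall i, i < K -> size (cells s h i) = e i].

Lemma size_cells s h h' i :
  (forall a, h.[? a] = Some (s (cvar i)) <-> h'.[? a] = Some (s (cvar i))) ->
  size (cells s h i) = size (cells s h' i).
Proof.
move=> E; apply: perm_size; apply: uniq_perm; rewrite ?cells_uniq // => a.
by rewrite !mem_cells; apply/eqP/eqP => /E.
Qed.

Lemma size_cells_seq s h i r : uniq r ->
  (forall a, h.[? a] = Some (s (cvar i)) <-> a \in r) -> size (cells s h i) = size r.
Proof.
move=> u E; apply: perm_size; apply: uniq_perm; rewrite ?cells_uniq // => a.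
by rewrite mem_cells; apply/eqP/idP => /E.
Qed.

(** All cells of color [i] are discarded before new ones are guessed, so the new count may be
    smaller or larger. *)
Definition numex K i p :=
  splf K (all_color K i) (And (Neg (exf K 0 (colorf 0 i))) (extf K (all_color K i) p)).

Lemma numeric_repl K s e h1 h2 h' i : inj_store K s -> i < K ->
  numeric K s e (h1 + h2)%fset -> dj h1 h2 ->
  (forall a b, h1.[? a] = Some b -> b = s (cvar i)) ->
  (forall a, h2.[? a] <> Some (s (cvar i))) ->
  good K s h' -> dj h2 h' -> (forall a b, h'.[? a] = Some b -> b = s (cvar i)) ->
  numeric K s (upd e i (size (cells s h' i))) (h2 + h')%fset.
Proof.
move=> inj li [g c n] d C1 C2 g' d' C'; split.
- by apply: good_join => //; apply: good_sub g; exact: subh_joinr.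
- move=> a b /(fnd_joinP _ _ d') [e2|/C' ->]; last by exists i.
  by apply: (c a); exact: subh_joinr.
move=> l ll; rewrite /upd; case: eqP => [->|ne].
  by apply: size_cells => a; rewrite (fnd_joinP _ _ d'); split=> [[/C2|]|]; auto.
rewrite -(n l ll); apply: size_cells => a; rewrite (fnd_joinP _ _ d) (fnd_joinP _ _ d').
by split=> -[E|E]; auto; case: ne; apply: (cvar_inj inj ll li); first [exact: C1 E|exact: C' E].
Qed.

(** Since [p] is assumed to depend on the counts only, any fresh locations serve for the new
    cells. *)
Lemma sat_numex K s e h i p (P : (nat -> nat) -> Prop) : inj_store K s -> i < K ->
  numeric K s e h ->
  (forall e' h', numeric K s e' h' -> sat s h' p <-> P e') ->
  sat s h (numex K i p) <-> exists a, P (upd e i a).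
Proof.
move=> inj li N IH; have [g c n] := N; rewrite (sat_spl0 inj) //; split.
  move=> [h1 [h2 [d E]]].
  have g1 : good K s h1 by apply: good_sub g; rewrite E; exact: subh_joinl.
  have g2 : good K s h2 by apply: good_sub g; rewrite E; exact: subh_joinr.
  move=> /(sat_all_color inj g1 li) C1 /sat_and [/(sat_no_color inj g2 li) C2].
  move=> /(sat_ext0 inj) [h' [g' d' /(sat_all_color inj g' li) C' S]].
  exists (size (cells s h' i)); apply/(IH _ (h2 + h')%fset) => //.
  by apply: numeric_repl C1 _ _ _ _ => //; rewrite -E.
move=> [m Pm]; pose h1 := mkheap (cells s h i) (fun _ => s (cvar i)).
have sb : subh h1 h.
  by move=> a b; rewrite fnd_mkheap mem_cells; case: eqP => // -> [<-].
have [d E] := subh_split sb; set h2 := h.[\ _] in d E.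
have g1 := good_sub sb g.
have g2 : good K s h2 by apply: good_sub g; rewrite E; exact: subh_joinr.
have C1 a b : h1.[? a] = Some b -> b = s (cvar i).
  by rewrite fnd_mkheap; case: ifP => // _ [<-].
have C2 a : h2.[? a] <> Some (s (cvar i)).
  rewrite fnd_rem; case: ifP => // /negbT /notin_domf.
  by rewrite fnd_mkheap mem_cells; case: eqP.
have [B1 hB1] := heap_bound h2; have [B2 hB2] := nonres_bound K s.
pose h' := mkheap (iota (B1 + B2) m) (fun _ => s (cvar i)).
have g' : good K s h'.
  move=> a b; rewrite fnd_mkheap mem_iota; case: ifP => // /andP [le _] [<-].
  by split; [apply: hB2; lia|move=> /inj; rewrite /cvar; lia].
have d' : dj h2 h'.
  move=> a; rewrite fnd_mkheap mem_iota; case: ifP => [/andP [le _]|]; last by right.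
  by left; apply: hB1; lia.
have C' a b : h'.[? a] = Some b -> b = s (cvar i).
  by rewrite fnd_mkheap; case: ifP => // _ [<-].
exists h1, h2; split=> //; first exact/(sat_all_color inj g1 li).
apply/sat_and; split; first exact/(sat_no_color inj g2 li).
apply/(sat_ext0 inj); exists h'; split=> //; first exact/(sat_all_color inj g' li).
apply/(IH (upd e i m)) => //.
have <- : size (cells s h' i) = m.
  rewrite -[RHS](size_iota (B1 + B2)); apply: size_cells_seq; first exact: iota_uniq.
  by move=> a; rewrite fnd_mkheap; case: ifP.
by apply: numeric_repl C1 _ _ _ _ => //; rewrite -E.
Qed.

Definition onef K i := splf K (And (all_color K i) size1) (Neg (exf K 0 (colorf 0 i))).

Lemma sat_onef K s h i : inj_store K s -> i < K -> good K s h ->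
  sat s h (onef K i) <-> size (cells s h i) = 1.
Proof.
move=> inj li g; rewrite (sat_spl0 inj) //; split.
- move=> [h1 [h2 [d E]]].
  have g1 : good K s h1 by apply: good_sub g; rewrite E; exact: subh_joinl.
  have g2 : good K s h2 by apply: good_sub g; rewrite E; exact: subh_joinr.
  move=> /sat_and [/(sat_all_color inj g1 li) C1 /sat_size1 [a [b e1]]].
  move=> /(sat_no_color inj g2 li) C2; rewrite -[RHS]/(size [:: a]).
  apply: size_cells_seq => // x; rewrite E (fnd_joinP _ _ d) inE e1 fnd_single.
  have -> : b = s (cvar i) by apply: (C1 a); rewrite e1 fnd_single eqxx.
  by case: eqP; split=> //; [left|case=> // /C2].
- case Ec: (cells s h i) => [|a []] // _.
  have cP x : h.[? x] = Some (s (cvar i)) <-> x = a.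
    by have := mem_cells s h i x; rewrite Ec inE => E; split=> /eqP; [rewrite -E|rewrite E] => /eqP.
  have sb : subh (single a (s (cvar i))) h.
    by move=> x y; rewrite fnd_single; case: eqP => // -> [<-]; exact/cP.
  have [d E] := subh_split sb; set h2 := h.[\ _] in d E.
  have g2 : good K s h2 by apply: good_sub g; rewrite E; exact: subh_joinr.
  exists (single a (s (cvar i))), h2; split=> //.
    apply/sat_and; split; last by apply/sat_size1; exists a, (s (cvar i)).
    apply/(sat_all_color inj (good_sub sb g) li) => x y.
    by rewrite fnd_single; case: eqP => // _ [<-].
  apply/(sat_no_color inj g2 li) => x; rewrite fnd_rem; case: ifP => // /negbT /notin_domf.
  by rewrite fnd_single; case: eqP => // n _ /cP.
Qed.

Definition env := nat -> nat.
Implicit Types (P Q : env -> Prop) (e : env).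

Definition ndef K P := exists p, forall s, inj_store K s ->
  forall e h, numeric K s e h -> sat s h p <-> P e.

Lemma ndef_ext K P Q : (forall e, P e <-> Q e) -> ndef K P -> ndef K Q.
Proof. by move=> E [p H]; exists p => s inj e h N; rewrite -E; exact: H. Qed.

Lemma ndef_not K P : ndef K P -> ndef K (fun e => ~ P e).
Proof. by move=> [p H]; exists (Neg p) => s inj e h N; rewrite sat_neg (H s inj e h N). Qed.

Lemma ndef_and K P Q : ndef K P -> ndef K Q -> ndef K (fun e => P e /\ Q e).
Proof.
move=> [p H] [q H']; exists (And p q) => s inj e h N.
by rewrite sat_and (H s inj e h N) (H' s inj e h N).
Qed.

Lemma ndef_or K P Q : ndef K P -> ndef K Q -> ndef K (fun e => P e \/ Q e).
Proof.
move=> [p H] [q H']; exists (orf p q) => s inj e h N.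
by rewrite sat_or (H s inj e h N) (H' s inj e h N).
Qed.

Lemma ndef_ex K P i : i < K -> ndef K P -> ndef K (fun e => exists a, P (upd e i a)).
Proof.
move=> li [p H]; exists (numex K i p) => s inj e h N.
by apply: sat_numex => // e' h'; exact: H.
Qed.

Lemma ndef_pos K i : i < K -> ndef K (fun e => 0 < e i).
Proof.
move=> li; exists (exf K 0 (colorf 0 i)) => s inj e h [g _ n].
rewrite (sat_ex_color inj g li) -(n i li) -has_predT; split=> [[a ea]|/hasP [a]].
- by apply/hasP; exists a; rewrite ?mem_cells ?ea.
- by rewrite mem_cells => /eqP; exists a.
Qed.

Lemma ndef_one K i : i < K -> ndef K (fun e => e i = 1).
Proof.
move=> li; exists (onef K i) => s inj e h [g _ n].
by rewrite (sat_onef inj li g) n.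
Qed.

Definition prodle a b c := [/\ 0 < a, 0 < b & a * b <= c].

Lemma ndef_prod K i j k : i < K -> j < K -> k < K -> i <> k -> j <> k -> i <> j ->
  ndef K (fun e => prodle (e i) (e j) (e k)).
Proof.
move=> li lj lk ik jk ij; exists (prodf K i j k) => s inj e h [g c n].
rewrite -!n //; split=> [|[]]; first exact: prod_sound.
exact: prod_complete.
Qed.

(** For positive [e i] this is [1 * e i <= e j], the factor 1 being held by the scratch color
    [u]. *)
Lemma ndef_le K i j u : i < K -> j < K -> u < K -> i <> j -> u <> i -> u <> j ->
  ndef K (fun e => e i <= e j).
Proof.
move=> li lj lu ij ui uj.
have N := ndef_ex lu (ndef_and (ndef_one lu) (ndef_prod lu li lj uj ij ui)).
apply: ndef_ext (ndef_or (ndef_not (ndef_pos li)) N) => e.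
rewrite /upd eqxx /prodle; case: (i =P u) => [//|_]; first by move=> E; case: ui.
case: (j =P u) => [E|_]; first by case: uj.
split=> [[|[a [-> []]]]|]; try lia.
case: (posnP (e i)) => [-> _|p le]; [left; lia|right].
by exists 1; split=> //; split=> //; lia.
Qed.

Lemma ndef_eq K i j u : i < K -> j < K -> u < K -> i <> j -> u <> i -> u <> j ->
  ndef K (fun e => e i = e j).
Proof.
move=> li lj lu ij ui uj.
have N1 := ndef_le li lj lu ij ui uj; have N2 := ndef_le lj li lu (nesym ij) uj ui.
by apply: ndef_ext (ndef_and N1 N2) => e; lia.
Qed.

Definition finite_support P :=
  exists n, forall e e', (forall i, i < n -> e i = e' i) -> P e -> P e'.

(* Quantifying over every renaming ix makes [def] stable under substitution of
   variables; finite support leaves a fresh variable for each quantifier. *)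
Definition def P := finite_support P /\
  forall ix : nat -> nat, exists K0, forall K, K0 <= K -> ndef K (fun e => P (fun i => e (ix i))).

Definition scons a e : env := fun i => if i is j.+1 then e j else a.

Lemma def_ext P Q : (forall e, P e <-> Q e) -> def P -> def Q.
Proof.
move=> E [[n F] D]; split; first by exists n => e e' /F; rewrite !E.
move=> ix; have [K0 H] := D ix; exists K0 => K /H; apply: ndef_ext => e; exact: E.
Qed.

Lemma def_not P : def P -> def (fun e => ~ P e).
Proof.
move=> [[n F] D]; split.
  by exists n => e e' E N p; apply: N; apply: F p => i /E.
by move=> ix; have [K0 H] := D ix; exists K0 => K /H; exact: ndef_not.
Qed.

Lemma def_and P Q : def P -> def Q -> def (fun e => P e /\ Q e).
Proof.
move=> [[n F] D] [[n' F'] D']; split.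
  exists (n + n') => e e' E [p q]; split; [apply: F p|apply: F' q] => i lt; apply: E; lia.
move=> ix; have [K0 H] := D ix; have [K1 H'] := D' ix; exists (K0 + K1) => K le.
by apply: ndef_and; [apply: H|apply: H']; lia.
Qed.

Lemma def_ren (r : nat -> nat) P : def P -> def (fun e => P (fun i => e (r i))).
Proof.
move=> [[n F] D]; split=> [|ix]; last exact: (D (fun i => ix (r i))).
exists (\max_(i < n) r i).+1 => e e' E; apply: F => i lt; apply: E.
by rewrite ltnS (leq_bigmax (Ordinal lt) (F := fun i : 'I_n => r i)).
Qed.

Lemma def_ex P : def P -> def (fun e => exists a, P (scons a e)).
Proof.
move=> [[n F] D]; split.
  by exists n => e e' E [a p]; exists a; apply: F p => -[|i] // lt; apply: E; exact: ltnW.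
(* Color [m] lies above every color that [P] reads after renaming, so overwriting it disturbs
   nothing. *)
move=> ix; pose m := (\max_(i < n) ix i).+1.
have lm i : i < n -> ix i < m.
  by move=> lt; rewrite ltnS (leq_bigmax (Ordinal lt) (F := fun i : 'I_n => ix i)).
have [K0 H] := D (scons m ix); exists (K0 + m.+1) => K le.
have {}H : ndef K (fun e => P (fun i => e (scons m ix i))) by apply: H; lia.
have lmK : m < K by lia.
apply: ndef_ext (ndef_ex lmK H) => e.
split=> -[a p]; exists a; apply: F p => -[|i] lt /=; rewrite /upd ?eqxx //.
all: by case: eqP => // E; have := lm i (ltnW lt); lia.
Qed.

Lemma def_or P Q : def P -> def Q -> def (fun e => P e \/ Q e).
Proof.
move=> dP dQ; apply: def_ext (def_not (def_and (def_not dP) (def_not dQ))) => e.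
by split=> [n|]; [apply: NNPP; tauto|tauto].
Qed.

Lemma def_imp P Q : def P -> def Q -> def (fun e => P e -> Q e).
Proof.
move=> dP dQ; apply: def_ext (def_or (def_not dP) dQ) => e.
by split; [tauto|case: (classic (P e)); tauto].
Qed.

Lemma def_all P : def P -> def (fun e => forall a, P (scons a e)).
Proof.
move=> dP; apply: def_ext (def_not (def_ex (def_not dP))) => e.
split=> [n a|A [a]]; last by apply; exact: A.
by apply: NNPP => N; apply: n; exists a.
Qed.

Lemma def_one : def (fun e => e 0 = 1).
Proof.
split; first by exists 1 => e e' E <-; rewrite E.
by move=> ix; exists (ix 0).+1 => K lt; exact: ndef_one.
Qed.

Lemma def_pos : def (fun e => 0 < e 0).
Proof.
split; first by exists 1 => e e' E; rewrite E.
by move=> ix; exists (ix 0).+1 => K lt; exact: ndef_pos.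
Qed.

(** A renaming may identify the three variables, whereas [prodf] needs distinct colors: their values
    are copied to [m], [m.+1] and [m.+2], with [m.+3] as scratch color for the equalities. *)
Lemma def_prodle : def (fun e => prodle (e 0) (e 1) (e 2)).
Proof.
split; first by exists 3 => e e' E; rewrite !E.
move=> ix; set x := ix 0; set y := ix 1; set z := ix 2.
pose m := (x + y + z).+1; exists m.+4 => K le.
have eqf i j : i < m.+3 -> j < m.+3 -> i <> j -> ndef K (fun e => e i = e j).
  by move=> li lj ij; apply: (@ndef_eq K i j m.+3); lia.
have N : ndef K (fun e => [/\ e m = e x, e m.+1 = e y & e m.+2 = e z] /\
                          prodle (e m) (e m.+1) (e m.+2)).
  apply: ndef_and; last by apply: ndef_prod; lia.
  apply: ndef_ext (ndef_and (ndef_and (eqf m x _ _ _) (eqf m.+1 y _ _ _)) (eqf m.+2 z _ _ _));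
    try lia.
  by move=> e; split=> [[[]]|[]].
have l0 : m < K by lia.
have l1 : m.+1 < K by lia.
have l2 : m.+2 < K by lia.
apply: ndef_ext (ndef_ex l0 (ndef_ex l1 (ndef_ex l2 N))) => e.
have E a b c : let e' := upd (upd (upd e m a) m.+1 b) m.+2 c in
    [/\ e' m = a, e' m.+1 = b & e' m.+2 = c] /\ [/\ e' x = e x, e' y = e y & e' z = e z].
  by rewrite /upd; do !split; repeat case: eqP => //; lia.
split=> [[a [b [c]]]|p].
- by have [[-> -> ->] [-> -> ->]] := E a b c; case=> [[-> -> ->]].
- by exists (e x), (e y), (e z); have [[-> -> ->] [-> -> ->]] := E (e x) (e y) (e z).
Qed.

Definition dterm (T : env -> nat) := def (fun e => e 0 = T (fun i => e i.+1)).

Lemma def_subst T P : dterm T -> def P -> def (fun e => P (scons (T e) e)).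
Proof.
move=> dT dP; apply: def_ext (def_ex (def_and dT dP)) => e.
by split=> [[a [/= ->]]|p] //; exists (T e).
Qed.

Lemma dterm_ren (r : nat -> nat) T : dterm T -> dterm (fun e => T (fun i => e (r i))).
Proof. exact: (def_ren (scons 0 (fun i => (r i).+1))). Qed.

(** The value substituted last is bound innermost and gets index 0, hence the reversed indices. *)
Lemma def_rel2 (R : nat -> nat -> Prop) T1 T2 : def (fun e => R (e 0) (e 1)) ->
  dterm T1 -> dterm T2 -> def (fun e => R (T1 e) (T2 e)).
Proof.
move=> /(def_ren (nth 0 [:: 1; 0])) dR d1 d2.
exact: (def_subst d1 (def_subst (dterm_ren succn d2) dR)).
Qed.

Lemma def_rel3 (R : nat -> nat -> nat -> Prop) T1 T2 T3 : def (fun e => R (e 0) (e 1) (e 2)) ->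
  dterm T1 -> dterm T2 -> dterm T3 -> def (fun e => R (T1 e) (T2 e) (T3 e)).
Proof.
move=> /(def_ren (nth 0 [:: 2; 1; 0])) dR d1 d2 d3.
exact: (def_subst d1 (def_subst (dterm_ren succn d2)
         (def_subst (dterm_ren (fun i => i.+2) d3) dR))).
Qed.

Lemma def_le01 : def (fun e => e 0 <= e 1).
Proof.
have d : def (fun e => e 0 = 1 /\ prodle (e 0) (e 1) (e 2)).
  exact: def_and def_one def_prodle.
apply: def_ext (def_or (def_not def_pos) (def_ex d)) => e.
rewrite /prodle /=; split=> [[|[a [-> []]]]|]; try lia.
case: (posnP (e 0)) => [-> _|p le]; [left; lia|right].
by exists 1; split=> //; split=> //; lia.
Qed.

Lemma def_eq01 : def (fun e => e 0 = e 1).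
Proof.
apply: def_ext (def_and def_le01 (def_ren (nth 0 [:: 1; 0]) def_le01)) => e /=; lia.
Qed.

Lemma dterm_var i : dterm (fun e => e i).
Proof. exact: (def_ren (nth 0 [:: 0; i.+1]) def_eq01). Qed.

Lemma def_eq_term T1 T2 : dterm T1 -> dterm T2 -> def (fun e => T1 e = T2 e).
Proof. exact: (def_rel2 (R := eq) def_eq01). Qed.

Lemma def_le_term T1 T2 : dterm T1 -> dterm T2 -> def (fun e => T1 e <= T2 e).
Proof. exact: (def_rel2 (R := fun a b => a <= b) def_le01). Qed.

Lemma def_lt_term T1 T2 : dterm T1 -> dterm T2 -> def (fun e => T1 e < T2 e).
Proof.
move=> d1 d2; apply: def_ext (def_not (def_le_term d2 d1)) => e; lia.
Qed.

Lemma dterm_zero : dterm (fun _ => 0).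
Proof. apply: def_ext (def_not def_pos) => e; lia. Qed.

(** The successor is the least number strictly above. *)
Lemma dterm_succ T : dterm T -> dterm (fun e => (T e).+1).
Proof.
move=> dT; have D : def (fun e => e 0 = (e 1).+1).
  have d : def (fun e => e 2 < e 0 -> e 1 <= e 0).
    by apply: def_imp; [apply: def_lt_term|apply: def_le_term]; exact: dterm_var.
  apply: def_ext (def_and (def_lt_term (dterm_var 1) (dterm_var 0)) (def_all d)) => e /=.
  by split=> [[lt /(_ (e 1).+1)]|->]; [lia|split=> // a; lia].
exact: (def_rel2 (R := fun a b => a = b.+1) D (dterm_var 0) (dterm_ren succn dT)).
Qed.

(** For positive factors the product is the least third argument of [prodle]; zero factors are
    treated apart. *)
Lemma dterm_mul T1 T2 : dterm T1 -> dterm T2 -> dterm (fun e => T1 e * T2 e).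
Proof.
move=> d1 d2; have D : def (fun e => e 0 = e 1 * e 2).
  have z i : def (fun e => e i = 0) := def_eq_term (dterm_var i) dterm_zero.
  have p : def (fun e => prodle (e 1) (e 2) (e 0)).
    exact: (def_ren (nth 0 [:: 1; 2; 0]) def_prodle).
  have q : def (fun e => prodle (e 2) (e 3) (e 0) -> e 1 <= e 0).
    apply: def_imp; last by apply: def_le_term; exact: dterm_var.
    exact: (def_ren (nth 0 [:: 2; 3; 0]) def_prodle).
  apply: def_ext (def_or (def_and (def_or (z 1) (z 2)) (z 0)) (def_and p (def_all q))) => e.
  rewrite /prodle /=; split=> [[[[->|->] ->]|[[p1 p2 le] /(_ (e 1 * e 2)) A]]|E]; rewrite ?muln0 //.
    by apply/eqP; rewrite eqn_leq le A.
  case: (posnP (e 1)) => p1; first by left; rewrite E p1; auto.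
  case: (posnP (e 2)) => p2; first by left; rewrite E p2 muln0; auto.
  by right; rewrite E; split=> // a [].
exact: (def_rel3 (R := fun a b c =>
  a = b * c) D (dterm_var 0) (dterm_ren succn d1) (dterm_ren succn d2)).
Qed.

(* Julia Robinson's definition of addition from multiplication and successor. *)
Lemma robinson_add a b c : (c = a + b) <->
  (c = 0 /\ (a = 0 /\ b = 0)) \/ (0 < c /\ (a * c).+1 * (b * c).+1 = (c * c * (a * b).+1).+1).
Proof.
case: (posnP c) => [->|c0]; first by split=> [|[]]; lia.
split=> [->|[]]; [right; split; [lia|nia]|lia|].
move=> [_ E]; have : c * c = c * (a + b) by nia.
by move/eqP; rewrite eqn_mul2l; case: eqP => [|_ /eqP]; lia.
Qed.

Lemma dterm_add T1 T2 : dterm T1 -> dterm T2 -> dterm (fun e => T1 e + T2 e).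
Proof.
move=> d1 d2; have D : def (fun e => e 0 = e 1 + e 2).
  have z i : def (fun e => e i = 0) := def_eq_term (dterm_var i) dterm_zero.
  have v := dterm_var.
  apply: (def_ext (fun e => iff_sym (robinson_add (e 1) (e 2) (e 0)))).
  apply: def_or; first exact: def_and (z 0) (def_and (z 1) (z 2)).
  apply: def_and; first exact: def_lt_term dterm_zero (v 0).
  apply: def_eq_term.
  - by apply: dterm_mul; apply: dterm_succ; apply: dterm_mul; exact: v.
  - apply: dterm_succ; apply: dterm_mul; first by apply: dterm_mul; exact: v.
    by apply: dterm_succ; apply: dterm_mul; exact: v.
exact: (def_rel3 (R := fun a b c =>
  a = b + c) D (dterm_var 0) (dterm_ren succn d1) (dterm_ren succn d2)).
Qed.

Lemma dterm_mod T1 T2 : dterm T1 -> dterm T2 -> dterm (fun e => T1 e %% (T2 e).+1).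
Proof.
move=> d1 d2; have D : def (fun e => e 0 = e 1 %% (e 2).+1).
  have v := dterm_var.
  have d : def (fun e => e 2 = e 0 * (e 3).+1 + e 1 /\ e 1 < (e 3).+1).
    apply: def_and; last by apply: def_lt_term => //; exact: dterm_succ.
    apply: def_eq_term => //; apply: dterm_add => //; apply: dterm_mul => //; exact: dterm_succ.
  apply: def_ext (def_ex d) => e /=; split=> [[q [-> lt]]|->].
    by rewrite modnMDl modn_small.
  by exists (e 1 %/ (e 2).+1); rewrite -divn_eq ltn_mod.
exact: (def_rel3 (R := fun a b c =>
  a = b %% c.+1) D (dterm_var 0) (dterm_ren succn d1) (dterm_ren succn d2)).
Qed.

(** * Gödel's beta function *)

Definition beta b c i := b %% (i.+1 * c).+1.

Lemma dterm_beta Tb Tc Ti : dterm Tb -> dterm Tc -> dterm Ti ->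
  dterm (fun e => beta (Tb e) (Tc e) (Ti e)).
Proof.
move=> db dc di; apply: dterm_mod => //; apply: dterm_mul => //; exact: dterm_succ.
Qed.

(** Eliminating [c] between the two moduli shows that a common divisor divides [j - i], hence [n!],
    hence [c], and therefore 1. *)
Lemma beta_coprime n c i j : n`! %| c -> i < j -> j <= n ->
  coprime (i.+1 * c).+1 (j.+1 * c).+1.
Proof.
move=> dv ij jn; rewrite /coprime -dvdn1; set d := gcdn _ _.
have di : d %| (i.+1 * c).+1 by exact: dvdn_gcdl.
have dj : d %| (j.+1 * c).+1 by exact: dvdn_gcdr.
have : d %| j.+1 * (i.+1 * c).+1 - i.+1 * (j.+1 * c).+1 by apply: dvdn_sub; exact: dvdn_mull.
have -> : j.+1 * (i.+1 * c).+1 - i.+1 * (j.+1 * c).+1 = j - i by nia.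
move=> dji; have dc : d %| c.
  by apply: dvdn_trans dji (dvdn_trans _ dv); apply: dvdn_fact; lia.
by move: di; rewrite -addn1 dvdn_addr // dvdn_mull.
Qed.

Lemma chinese_seq n (m a : nat -> nat) :
  (forall i j, i < j -> j < n -> coprime (m i) (m j)) ->
  exists b, forall i, i < n -> b = a i %[mod m i].
Proof.
elim: n => [|n IH] co; first by exists 0.
have [|b hb] := IH; first by move=> i j ij jn; apply: co; lia.
pose M := \prod_(i < n) m i.
have cM : coprime M (m n).
  apply: (big_ind (fun x => coprime x (m n))) => [|x y cx cy|i _]; first exact: coprime1n.
  - by rewrite coprimeMl cx.
  - exact: co.
exists (chinese M (m n) b (a n)) => i; rewrite ltnS leq_eqVlt => /orP [/eqP ->|lt].
  exact: chinese_modr.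
rewrite -(hb i lt).
have dv : m i %| M by rewrite /M (bigD1 (Ordinal lt)) //= dvdn_mulr.
by rewrite -(modn_dvdm _ dv) chinese_modl // modn_dvdm.
Qed.

Lemma beta_exists n (a : nat -> nat) : exists b c, forall i, i <= n -> beta b c i = a i.
Proof.
(* The factorial makes the moduli coprime, the sum makes each of them exceed the value it has to
   encode. *)
pose c := n`! * (\sum_(i < n.+1) a i).+1.
have [|b hb] := @chinese_seq n.+1 (fun i => (i.+1 * c).+1) a.
  by move=> i j ij jn; apply: (@beta_coprime n); rewrite ?dvdn_mulr.
exists b, c => i lt; rewrite /beta hb // modn_small //.
have : a i <= \sum_(i < n.+1) a i by rewrite (bigD1 (inord i)) //= inordK // leq_addr.
have : 0 < n`! by exact: fact_gt0.
by rewrite /c; nia.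
Qed.

(** * Partial recursive functions are definable *)

Definition etuple n (e : env) : n.-tuple nat := [tuple e i | i < n].

(** Unrolls the recursion into the sequence of its values, which the beta function can encode. *)
Lemma reval_rprec n (f : recfun n) (g : recfun n.+2) (v : n.+1.-tuple nat) y :
  reval (rprec f g) v y <-> exists w : nat -> nat,
    [/\ reval f [tuple of behead v] (w 0),
      forall k, k < thead v -> reval g [tuple of k :: w k :: behead v] (w k.+1)
    & w (thead v) = y].
Proof.
rewrite /=; elim: (thead v) y => [|k IH] y.
  by split=> [r|[w [r _ <-]]] //; exists (fun _ => y).
split=> [[z /IH [w [w0 ws wk]] r]|[w [w0 ws wk]]].
- exists (fun i => if i <= k then w i else y); split=> //; last by rewrite ltnn.
  move=> i le; have [->|lt] : i = k \/ i < k by lia.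
    by rewrite leqnn ltnn wk.
  by rewrite lt (ltnW lt); exact: ws.
- exists (w k); last by rewrite -wk; exact: ws.
  by apply/IH; exists w; split=> // i lt; apply: ws; exact: ltnW.
Qed.

Lemma def_finite_all (I : finType) (P : I -> env -> Prop) :
  (forall i, def (P i)) -> def (fun e => forall i, P i e).
Proof.
move=> D; suff H (r : seq I) : def (fun e => forall i, i \in r -> P i e).
  by apply: def_ext (H (enum I)) => e; split=> A i; [apply: A; rewrite mem_enum|move=> _; exact: A].
elim: r => [|x r IH]; first by apply: def_ext (def_eq_term dterm_zero dterm_zero) => e.
apply: def_ext (def_and (D x) IH) => e; split=> [[p A] i|A].
- by rewrite inE => /orP [/eqP ->|/A].
- by split=> [|i ir]; apply: A; rewrite inE ?eqxx ?ir ?orbT.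
Qed.

Definition sapp (w : seq nat) e : env := foldr scons e w.

Lemma def_ex_tuple m P : def P -> def (fun e => exists w : m.-tuple nat, P (sapp w e)).
Proof.
elim: m P => [|m IH] P D.
  by apply: def_ext D => e; split=> [p|[w]]; [exists [tuple]|rewrite (tuple0 w)].
apply: def_ext (IH _ (def_ex D)) => e; split=> [[w [a p]]|[w p]].
- by exists [tuple of a :: w].
- by exists [tuple of behead w], (thead w); rewrite [w]tuple_eta in p.
Qed.

Lemma sapp_l w e i : i < size w -> sapp w e i = nth 0 w i.
Proof. by elim: w i => [|a w IH] [|i] //= /IH. Qed.

Lemma sapp_r w e i : sapp w e (size w + i) = e i.
Proof. by elim: w => //= a w; rewrite addSn. Qed.

Lemma def_reval n (f : recfun n) : def (fun e => reval f (etuple n (fun i => e i.+1)) (e 0)).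
Proof.
elim: f => {n} [||n i|m n f IHf g IHg|n f IHf g IHg|n f IHf].
- exact: dterm_zero.
- apply: def_ext (def_eq_term (dterm_var 0) (dterm_succ (dterm_var 1))) => e.
  by rewrite /= /thead tnth_mktuple.
- by apply: def_ext (def_eq_term (dterm_var 0) (dterm_var i.+1)) => e; rewrite /= tnth_mktuple.
(* The [m] intermediate values occupy the indices below [m], the output is at [m] and the arguments
   follow. *)
- have Dg (i : 'I_m) : def (fun e => reval (g i) (etuple n (fun j => e (m + j.+1))) (e i)).
    exact: (def_ren (scons i (fun j => m + j.+1)) (IHg i)).
  have Df : def (fun e => reval f (etuple m e) (e m)).
    exact: (def_ren (scons m id) IHf).
  apply: def_ext (def_ex_tuple m (def_and (def_finite_all Dg) Df)) => e.
  have E (w : m.-tuple nat) :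
    [/\ etuple n (fun j => sapp w e (m + j.+1)) = etuple n (fun j => e j.+1),
        forall i : 'I_m, sapp w e i = tnth w i, etuple m (sapp w e) = w & sapp w e m = e 0].
    have sr k : sapp w e (m + k) = e k by have := sapp_r w e k; rewrite size_tuple.
    have sl (i : 'I_m) : sapp w e i = tnth w i.
      by rewrite sapp_l ?size_tuple // (tnth_nth 0).
    split=> //; last by have := sr 0; rewrite addn0.
    - by apply: eq_from_tnth => i; rewrite !tnth_mktuple sr.
    - by apply: eq_from_tnth => i; rewrite tnth_mktuple sl.
  split=> [[w [A r]]|[w A r]]; have [E1 E2 E3 E4] := E w; exists w.
  + by move=> i; have := A i; rewrite E1 E2.
  + by rewrite -E4 -{1}E3.
  + by split=> [i|]; [rewrite E1 E2; exact: A|rewrite E3 E4].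
- have v := dterm_var.
  have b0 i j : dterm (fun e => beta (e i) (e j) 0) by apply: dterm_beta => //; exact: dterm_zero.
  have bt i j k : dterm (fun e => beta (e i) (e j) (e k)) by apply: dterm_beta; exact: v.
  have bS i j k : dterm (fun e => beta (e i) (e j) (e k).+1).
    by apply: dterm_beta => //; exact: dterm_succ.
  (* Indices: 0 and 1 for the beta parameters [c] and [b], 2 for the output, 3 for the recursion
     argument, then the parameters. *)
  have D0 : def (fun e => reval f (etuple n (fun i => e i.+4)) (beta (e 1) (e 0) 0)).
    exact: (def_subst (b0 1 0) (def_ren (scons 0 (fun i => i.+4.+1)) IHf)).
  (* After both substitutions 0 is the value at [k.+1], 1 the value at [k], 2 is [k] itself, and the
     parameters start at 7. *)
  have D1 := def_subst (bt 2 1 0) (def_subst (bS 3 2 1)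
               (def_ren (scons 0 (scons 2 (scons 1 (fun i => 7 + i)))) IHg)).
  have D2 := def_all (def_imp (def_lt_term (v 0) (v 4)) D1).
  have D3 := def_eq_term (bt 1 0 3) (v 2).
  apply: def_ext (def_ex (def_ex (def_and D0 (def_and D2 D3)))) => e.
  rewrite reval_rprec.
  have -> : thead (etuple n.+1 (fun i => e i.+1)) = e 1 by rewrite /thead tnth_mktuple.
  have Eu : [tuple of behead (etuple n.+1 (fun i => e i.+1))] = etuple n (fun i => e i.+2).
    by apply: eq_from_tnth => i; rewrite tnth_behead !tnth_mktuple inordK // ltnS.
  have Ek k z (F : env) : (forall i, F i.+2 = e i.+2) -> F 0 = k -> F 1 = z ->
      etuple n.+2 F = [tuple of k :: z :: behead (etuple n.+1 (fun i => e i.+1))].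
    move=> F2 F0 F1; apply: eq_from_tnth => i; rewrite tnth_mktuple !(tnth_nth 0) /=.
    case: i => -[|[|i]] //= lt; have lt' : i.+1 < n.+1 by [].
    by rewrite F2 nth_behead -[i.+1]/(nat_of_ord (Ordinal lt')) nth_mktuple.
  rewrite Eu; split=> [[b [c [r0 [rs rk]]]]|[w [r0 rs rk]]].
  + exists (beta b c); split=> // k lt; have := rs k lt.
    by rewrite (Ek k (beta b c k)).
  + have [b [c bc]] := beta_exists (e 1) w; exists b, c; split; last split=> /=.
    * by rewrite /= bc.
    * move=> k lt; rewrite !bc //; last exact: ltnW.
      by rewrite (Ek k (w k)) //; exact: rs.
    * by rewrite bc.
- have D0 : def (fun e => reval f (etuple n.+1 e) 0).
    exact: (def_subst dterm_zero IHf).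
  (* Here 0 is [z.+1], 1 is [z], 2 is [k], 3 is the output, and the arguments start at 4. *)
  have D1 := def_ex (def_subst (dterm_succ (dterm_var 0))
               (def_ren (scons 0 (scons 2 (fun i => 4 + i))) IHf)).
  have D2 := def_all (def_imp (def_lt_term (dterm_var 0) (dterm_var 1)) D1).
  apply: def_ext (def_and D0 D2) => e /=.
  have E k (F : env) : F 0 = k -> (forall i, F i.+1 = e i.+1) ->
      etuple n.+1 F = [tuple of k :: etuple n (fun i => e i.+1)].
    move=> F0 F1; apply: eq_from_tnth => i; rewrite tnth_mktuple (tnth_nth 0) /=.
    case: i => -[|i] //= lt; have lt' : i < n by [].
    by rewrite F1 -[i]/(nat_of_ord (Ordinal lt')) nth_mktuple.
  by rewrite (E (e 0)) //; split=> -[r A]; split=> // k /A [z rz]; exists z; move: rz;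
    rewrite (E k) //.
Qed.

(** * The diagonal argument *)

Lemma numeric_mono K s h n : 0 < K -> inj_store K s -> good K s h ->
  (forall a b, h.[? a] = Some b -> b = s (cvar 0)) -> #|` domf h| = n ->
  numeric K s (scons n (fun _ => 0)) h.
Proof.
move=> K0 inj g C c; split=> //; first by move=> a b /C ->; exists 0.
case=> [|i] li.
- rewrite -[RHS]c; apply: size_cells_seq; first exact: fset_uniq.
  move=> a; split=> [e|/in_domf [b e]]; first by apply/in_domf; exists (s (cvar 0)).
  by rewrite e (C _ _ e).
- apply: (@size_cells_seq _ _ _ [::]) => // a; split=> // /C /(cvar_inj inj li K0).
  by [].
Qed.

Definition distinctf n := conjf n (fun v => conjf v (fun w => Neg (Eq v w))).

Lemma sat_distinct s h K : sat s h (distinctf (5 + K)) <-> inj_store K s.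
Proof.
rewrite /distinctf sat_conj; split=> [A v w lv lw e|inj v lv].
- case: (ltngtP v w) => // lt.
  + by have := A w lw; rewrite sat_conj => /(_ v lt); rewrite sat_neg sat_eq e.
  + by have := A v lv; rewrite sat_conj => /(_ w lt); rewrite sat_neg sat_eq e.
- apply/sat_conj => w lw; rewrite sat_neg sat_eq => /inj - /(_ lv (ltn_trans lw lv)) e.
  by rewrite e ltnn in lw.
Qed.

(** The formula [p] does not depend on [n]; it forces every cell to have color 0, so that the size
    of the heap becomes the value of variable 0. *)
Lemma representation (f : recfun 1) : exists p, forall n,
  satisfiable (And (szf n) p) <-> reval f [tuple n] 0.
Proof.
(* Substituting 0 for the output moves the input to index 0; [K0.+1] colors ensure that color 0
   exists. *)
have [_ /(_ id) [K0 /(_ K0.+1 (leqnSn _)) [p H]]] := def_subst dterm_zero (def_reval f).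
set K := K0.+1 in H; exists (And (distinctf (5 + K)) (And (goodf K) (And (all_color K 0) p))) => n.
have E : etuple 1 (scons n (fun _ => 0)) = [tuple n].
  by apply: eq_from_tnth => i; rewrite tnth_mktuple (tnth_nth 0) (ord1 i).
split=> [[s [h /sat_and [/sat_szf c /sat_and [/sat_distinct inj]]]]|r].
  move=> /sat_and [/(sat_good inj) g /sat_and [/(sat_all_color inj g (ltn0Sn _)) C]].
  by move=> /(H s inj _ _ (numeric_mono (ltn0Sn _) inj g C c)); rewrite -E.
(* Under the identity store, 5 is the location of color 0, and the cells lie beyond all
   variables. *)
pose s : store := id; pose h := mkheap (iota (5 + K) n) (fun _ => 5).
have inj : inj_store K s by [].
have c : #|` domf h| = n.
  rewrite -[RHS](size_iota (5 + K)); apply: perm_size; apply: uniq_perm.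
  - exact: fset_uniq.
  - exact: iota_uniq.
  - move=> a; apply/idP/idP => [/in_domf [b]|k]; first by rewrite fnd_mkheap; case: ifP.
    by apply/in_domf; exists 5; rewrite fnd_mkheap k.
have C a b : h.[? a] = Some b -> b = s (cvar 0).
  by rewrite fnd_mkheap; case: ifP => // _ [<-].
have g : good K s h.
  move=> a b e; split; last by rewrite (C _ _ e).
  move: e; rewrite fnd_mkheap mem_iota; case: ifP => // /andP [le _] _ w lw E'.
  by move: lw; rewrite -[w]E' ltnNge le.
exists s, h; apply/sat_and; split; first exact/sat_szf.
apply/sat_and; split; first exact/sat_distinct.
apply/sat_and; split; first exact/(sat_good inj).
apply/sat_and; split; first exact/(sat_all_color inj g (ltn0Sn _)).
by apply/(H s inj _ _ (numeric_mono (ltn0Sn _) inj g C c)); rewrite -E in r.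
Qed.

(** * Recursive functions computing codes of formulas *)

Lemma ord0_absurd (i : 'I_0) : False. Proof. by case: i. Qed.

Definition rcomp1 n (f : recfun 1) (g : recfun n) : recfun n := rcomp f (fun _ : 'I_1 => g).
Definition rcomp2 n (f : recfun 2) (g1 g2 : recfun n) : recfun n :=
  rcomp f (fun i : 'I_2 => if i == ord0 then g1 else g2).
Fixpoint rconst n c : recfun n :=
  if c is c'.+1 then rcomp1 rsucc (rconst n c')
  else rcomp rzero (fun i : 'I_0 => False_rect _ (ord0_absurd i)).

Lemma reval_rcomp1 n f (g : recfun n) v x y :
  reval g v x -> reval f [tuple x] y -> reval (rcomp1 f g) v y.
Proof. by move=> rg rf; exists [tuple x] => // i; rewrite (ord1 i). Qed.

Lemma rcomp1_reval n f (g : recfun n) v y : reval (rcomp1 f g) v y ->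
  exists2 x, reval g v x & reval f [tuple x] y.
Proof.
move=> [w rw rf]; exists (tnth w ord0); first exact: rw.
suff -> : [tuple tnth w ord0] = w by [].
by apply: eq_from_tnth => i; rewrite (ord1 i).
Qed.

Lemma reval_rcomp2 n f (g1 g2 : recfun n) v x1 x2 y :
  reval g1 v x1 -> reval g2 v x2 -> reval f [tuple x1; x2] y ->
  reval (rcomp2 f g1 g2) v y.
Proof.
move=> r1 r2 rf; exists [tuple x1; x2] => // -[[|[|i]] lt] //.
Qed.

Lemma reval_rconst n c v : reval (rconst n c) v c.
Proof.
elim: c => [|c IH]; last by apply: (reval_rcomp1 IH).
by exists [tuple] => // -[].
Qed.

Definition rproj0 n : recfun n.+1 := rproj (@Ordinal n.+1 0 isT).
Definition rproj1 n : recfun n.+2 := rproj (@Ordinal n.+2 1 isT).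
Definition rproj2 n : recfun n.+3 := rproj (@Ordinal n.+3 2 isT).

Definition radd : recfun 2 := rprec (rproj0 0) (rcomp1 rsucc (rproj1 1)).
Definition rmul : recfun 2 := rprec (rconst 1 0) (rcomp2 radd (rproj1 1) (rproj2 0)).
Definition rexp : recfun 1 := rprec (rconst 0 1) (rcomp2 radd (rproj1 0) (rproj1 0)).

Lemma reval_radd a b : reval radd [tuple a; b] (a + b).
Proof.
apply/reval_rprec; exists (fun k => k + b); split=> // k _.
exact: (reval_rcomp1 (x := k + b)).
Qed.

Lemma reval_rmul a b : reval rmul [tuple a; b] (a * b).
Proof.
apply/reval_rprec; exists (fun k => k * b); split=> //; first exact: reval_rconst.
move=> k _; apply: (reval_rcomp2 (x1 := k * b) (x2 := b)) => //.
by rewrite mulSn addnC; exact: reval_radd.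
Qed.

Lemma reval_rexp a : reval rexp [tuple a] (2 ^ a).
Proof.
apply/reval_rprec; exists (fun k => 2 ^ k); split=> //; first exact: reval_rconst.
move=> k _; apply: (reval_rcomp2 (x1 := 2 ^ k) (x2 := 2 ^ k)) => //.
by rewrite expnS mul2n -addnn; exact: reval_radd.
Qed.

(** Follows the recursion of [CodeSeq.code], which sends [x :: l] to [2 ^ x * (2 * code l + 1)] and
    the empty sequence to 0. *)
Definition rcode n (f g : recfun n) : recfun n :=
  rcomp2 rmul (rcomp1 rexp f) (rcomp1 rsucc (rcomp2 radd g g)).

Lemma reval_rcode n (f g : recfun n) v x l : reval f v x -> reval g v (CodeSeq.code l) ->
  reval (rcode f g) v (CodeSeq.code (x :: l)).
Proof.
move=> rf rg; apply: reval_rcomp2; last exact: reval_rmul.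
- exact: reval_rcomp1 rf (reval_rexp _).
- rewrite -addnn; apply: reval_rcomp1; last exact: erefl.
  exact: (reval_rcomp2 rg rg (reval_radd _ _)).
Qed.

Definition rcode3 n (f g k : recfun n) : recfun n :=
  rcode f (rcode g (rcode k (rconst n 0))).

Lemma reval_rcode3 n (f g k : recfun n) v x y z : reval f v x -> reval g v y ->
  reval k v z -> reval (rcode3 f g k) v (CodeSeq.code [:: x; y; z]).
Proof.
move=> rf rg rk.
exact: (reval_rcode rf (reval_rcode rg (reval_rcode (l := [::]) rk (reval_rconst 0 v)))).
Qed.

(** The constant 6 is the tag of [Star] in [form_code]; [rproj1 0] is the code of the previous
    stage. *)
Definition rszf : recfun 1 :=
  rprec (rconst 0 (form_code Emp))
        (rcode3 (rconst 2 6) (rconst 2 (form_code size1)) (rproj1 0)).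

Lemma reval_rszf n : reval rszf [tuple n] (form_code (szf n)).
Proof.
apply/reval_rprec; exists (fun k => form_code (szf k)); split=> //; first exact: reval_rconst.
move=> k _; apply: (@reval_rcode3 _ _ _ _ _ 6 (form_code size1) (form_code (szf k))) => //;
  exact: reval_rconst.
Qed.

(** The constant 5 is the tag of [And]. The input is used twice, as the number of cells and as the
    code of the second conjunct. *)
Definition rdiag : recfun 1 := rcode3 (rconst 1 5) rszf (rproj0 0).

Lemma reval_rdiag p : reval rdiag [tuple form_code p]
  (form_code (And (szf (form_code p)) p)).
Proof.
apply: (@reval_rcode3 _ _ _ _ _ 5 _ (form_code p)) => //; first exact: reval_rconst.
exact: reval_rszf.
Qed.

Theorem theorem3p12 : ~ recursively_decidable form_code satisfiable.
Proof.
move=> [f dec]; have [p rep] := representation (rcomp1 f rdiag).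
have [yes no] := dec (And (szf (form_code p)) p); set q := And _ _ in yes no.
(* On the code of [p], [rdiag] returns the code of [q], so [q] is satisfiable iff [f] rejects it. *)
have repq : satisfiable q <-> reval f [tuple form_code q] 0.
  rewrite rep; split=> [/rcomp1_reval [x rx rf]|]; last exact: reval_rcomp1 (reval_rdiag p).
  by rewrite (reval_functional (reval_rdiag p) rx).
case: (classic (satisfiable q)) => sq.
- by have := reval_functional (yes sq) (proj1 repq sq).
- by case: (sq); apply/repq/no.
Qed.
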